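(* Let $\gamma$ be a translation-invariant (nonnull) specification, $\nu\in\mathcal G_{\mathrm{inv}}(\gamma)$, and $\mu\in\mathcal M^+_{1,\mathrm{inv}}$. Assume Condition C1: $\mu(\Omega^{\le0}_\gamma)=1$, and Condition C2: $\mu\in\mathcal G_{\mathrm{inv}}(\gamma)$ and $\lim_{n\to\infty}\frac1{|\Lambda_n|}\log\frac{\mu(+_{\Lambda_n})}{\nu(+_{\Lambda_n})}=0$. Then: (1) $h(\mu|\nu)$ exists and $h(\mu|\nu)=0$; (2) $e^+_\nu$ exists and $e^+_\nu=e^+_\mu$; (3) $h(\alpha|\nu)$ exists for every $\alpha\in\mathcal M^+_{1,\mathrm{inv}}$ with $\alpha(\Omega^{\le0}_\gamma)=1$.
   Context: Let $E$ be a finite set containing a distinguished element $+1$, $\Omega=E^{\mathbb Z^d}$ with product topology and Borel $\sigma$-field $\mathcal F$; $\mathcal F_\Lambda$ is generated by the coordinates in $\Lambda$; $\mathcal S$ = finite subsets of $\mathbb Z^d$; $\mu(\sigma_\Lambda)=\mu(\{\omega:\omega_\Lambda=\sigma_\Lambda\})$; local functions are $\mathcal F_\Delta$-measurable for some finite $\Delta$. Translations $(\tau_x\omega)(y)=\omega(x+y)$; $\mathcal M^+_{1,\mathrm{inv}}$ = translation-invariant probability measures. A specification $\gamma=(\gamma_\Lambda)_{\Lambda\in\mathcal S}$ is a family of probability kernels, $\mathcal F_{\Lambda^c}$-measurable in the boundary condition, proper ($\gamma_\Lambda(B|\omega)=1_B(\omega)$ for $B\in\mathcal F_{\Lambda^c}$)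 and consistent ($\int\gamma_\Lambda(A|\omega')\gamma_{\Lambda'}(d\omega'|\omega)=\gamma_{\Lambda'}(A|\omega)$ for $\Lambda\subset\Lambda'$ and all $\omega$), and nonnull ($0<a_\Lambda<\inf_{\sigma,\eta}\gamma_\Lambda(\sigma_\Lambda|\eta)\le\sup_{\sigma,\eta}\gamma_\Lambda(\sigma_\Lambda|\eta)<b_\Lambda<1$); translation-invariant means $\gamma_{\Lambda+x}(A|\omega)=\gamma_\Lambda(\tau_xA|\tau_x\omega)$. $\mathcal G(\gamma)$: probability measures $\mu$ with $\mu(A|\mathcal F_{\Lambda^c})=\gamma_\Lambda(A|\cdot)$ $\mu$-a.s. for all $\Lambda, A$; $\mathcal G_{\mathrm{inv}}(\gamma)=\mathcal G(\gamma)\cap\mathcal M^+_{1,\mathrm{inv}}$. $\Omega_\gamma$ is the set of $\omega$ such that $\omega'\mapsto\int f\,d\gamma_\Lambda(\cdot|\omega')$ is continuous at $\omega$ for all $\Lambda\in\mathcal S$ and local $f$. $+$ is the configuration identically $+1$ and $+_\Lambda$ its restriction to $\Lambda$. With $\le$ the lexicographic order on $\mathbb Z^d$, $\sigma^+(x)=\sigma(x)$ for $x\le0$ and $\sigma^+(x)=+1$ for $x>0$; $\Omega^{\le0}_\gamma=\{\sigma:\sigma^+\in\Omega_\gamma\}$. $\Lambda_n=[-n,n]^d\cap\mathbb Z^d$. For a probability measure $\rho$, $e^+_\rho=-\lim_n|\Lambda_n|^{-1}\log\rho(+_{\Lambda_n})$ when the limit exists. $h_\Lambda(\mu|\nu)=\sum_{\sigma_\Lambda}\mu(\sigma_\Lambda)\log\frac{\mu(\sigma_\Lambda)}{\nu(\sigma_\Lambda)}$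 and $h(\mu|\nu)=\lim_n|\Lambda_n|^{-1}h_{\Lambda_n}(\mu|\nu)$ when the limit exists. *)

(* Defs.v *)
From HB Require Import structures.
From mathcomp Require Import all_boot all_order all_algebra finmap.
From mathcomp Require Import all_classical all_reals all_analysis measurable_realfun.

Unset Printing Implicit Defensive.
Import Order.TTheory GRing.Theory Num.Theory numFieldNormedType.Exports.
Local Open Scope classical_set_scope.
Local Open Scope ring_scope.


Definition site (d : nat) := {ffun 'I_d -> int}.

Definition sadd {d} (x y : site d) : site d := [ffun i => x i + y i].

Definition lex_lt {d} (x y : site d) : bool :=
  [exists i : 'I_d, [forall j : 'I_d, (j < i)%N ==> (x j == y j)] && (x i < y i)].

Definition site0 d : site d := [ffun=> 0].

(* Configurations Omega = E^{Z^d}; the point [plus] is only used to equip the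
   type with the pointedType structure required by mathcomp-analysis. *)
Definition Conf {E : finType} (plus : E) (d : nat) := site d -> E.
HB.instance Definition _ {E : finType} (plus : E) {d : nat} :=
  Choice.on (Conf plus d).
HB.instance Definition _ {E : finType} (plus : E) {d : nat} :=
  isPointed.Build (Conf plus d) (fun _ => plus).

Definition coordG {E : finType} (plus : E) {d : nat} (D : set (site d)) :
  set (set (Conf plus d)) :=
  [set A | exists x e, D x /\ A = [set w : Conf plus d | w x = e]].

Definition FD {E : finType} (plus : E) {d : nat} (D : set (site d)) :
  set (set (Conf plus d)) := <<s coordG plus D >>.

Definition Omega {E : finType} (plus : E) (d : nat) :=
  g_sigma_algebraType (coordG plus (@setT (site d))).

Definition compl_of {d} (L : {fset site d}) : set (site d) := ~` [set x | x \in L].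

Definition tau {E : finType} (plus : E) {d : nat} (x : site d) (w : Omega plus d) :
  Omega plus d := fun y => w (sadd x y).

Definition fshift {d} (L : {fset site d}) (x : site d) : {fset site d} :=
  ([fset sadd y x | y in L])%fset.

Definition cyl {E : finType} (plus : E) {d : nat} {L : {fset site d}}
  (s : {ffun L -> E}) : set (Omega plus d) :=
  [set w | forall x : L, w (fsval x) = s x].

Definition plusL {E : finType} (plus : E) {d : nat} (L : {fset site d}) : {ffun L -> E} :=
  [ffun=> plus].

Definition agree {E : finType} (plus : E) {d : nat} (D : set (site d))
  (w w' : Omega plus d) := forall x, D x -> w x = w' x.

Definition kernel_family (R : realType) {E : finType} (plus : E) (d : nat) :=
  {fset site d} -> Omega plus d -> probability (Omega plus d) R.

Local Open Scope ereal_scope.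

Definition is_specification {R : realType} {E : finType} (plus : E) {d : nat}
  (g : kernel_family R plus d) : Prop :=
  [/\ (forall (L : {fset site d}) (A : set (Omega plus d)), measurable A ->
       forall U : set (\bar R), measurable U ->
         FD plus (compl_of L) ((fun w => g L w A) @^-1` U)),
      (forall (L : {fset site d}) (B : set (Omega plus d)) w, FD plus (compl_of L) B -> g L w B = (\1_B w)%:E) &
      (forall (L L' : {fset site d}) (A : set (Omega plus d)) w, (L `<=` L')%fset -> measurable A ->
         \int[g L' w]_w' (g L w' A) = g L' w A)].

Definition nonnull {R : realType} {E : finType} (plus : E) {d : nat}
  (g : kernel_family R plus d) : Prop :=
  forall L : {fset site d}, L != fset0 ->
  exists a b : R, (0 < a)%R /\ (b < 1)%R /\
    forall (s : {ffun L -> E}) (eta : Omega plus d),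
      a%:E < g L eta (cyl plus s) /\ g L eta (cyl plus s) < b%:E.

Definition translation_invariant_spec {R : realType} {E : finType} (plus : E) {d : nat}
  (g : kernel_family R plus d) : Prop :=
  forall (L : {fset site d}) (x : site d) w (A : set (Omega plus d)), measurable A ->
    g (fshift L x) w A = g L (tau plus x w) (tau plus x @` A).

Definition translation_invariant {R : realType} {E : finType} (plus : E) {d : nat}
  (mu : probability (Omega plus d) R) : Prop :=
  forall (x : site d) (A : set (Omega plus d)), measurable A -> mu (tau plus x @^-1` A) = mu A.

(* mu in G(gamma): gamma_L(A|.) is a version of mu(A | F_{L^c}) *)
Definition gibbs {R : realType} {E : finType} (plus : E) {d : nat}
  (g : kernel_family R plus d) (mu : probability (Omega plus d) R) : Prop :=
  forall (L : {fset site d}) (A B : set (Omega plus d)), measurable A -> FD plus (compl_of L) B ->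
    mu (A `&` B) = \int[mu]_(w in B) g L w A.

Definition gibbs_inv {R : realType} {E : finType} (plus : E) {d : nat}
  (g : kernel_family R plus d) (mu : probability (Omega plus d) R) : Prop :=
  gibbs plus g mu /\ translation_invariant plus mu.

Local Close Scope ereal_scope.

Definition local_fun {R : realType} {E : finType} (plus : E) {d : nat}
  (f : Omega plus d -> R) : Prop :=
  exists D : {fset site d}, forall U : set R, measurable U ->
    FD plus [set x | x \in D] (f @^-1` U).

(* continuity at w for the product topology (E discrete): basic
   neighbourhoods of w are the cylinders {w' | w'_D = w_D}, D finite *)
Definition continuous_at_conf {R : realType} {E : finType} (plus : E) {d : nat}
  (F : Omega plus d -> R) (w : Omega plus d) : Prop :=
  forall e : R, 0 < e -> exists D : {fset site d},
    forall w', agree plus [set x | x \in D] w w' -> `|F w' - F w| < e.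

Definition Omega_gamma {R : realType} {E : finType} (plus : E) {d : nat}
  (g : kernel_family R plus d) : set (Omega plus d) :=
  [set w | forall (L : {fset site d}) (f : Omega plus d -> R), local_fun plus f ->
     continuous_at_conf plus (fun w' => fine (\int[g L w']_x (f x)%:E)) w].

Definition conf_plus {E : finType} (plus : E) {d : nat} (s : Omega plus d) :
  Omega plus d := fun x => if lex_lt (site0 d) x then plus else s x.

Definition Omega_le0 {R : realType} {E : finType} (plus : E) {d : nat}
  (g : kernel_family R plus d) : set (Omega plus d) :=
  [set s | Omega_gamma plus g (conf_plus plus s)].

Definition box_pt {d : nat} {n : nat} (k : {ffun 'I_d -> 'I_(2 * n + 1)}) : site d :=
  [ffun i => (val (k i))%:Z - n%:Z].
Definition Lambda d (n : nat) : {fset site d} :=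
  ([fset box_pt k | k in {: {ffun 'I_d -> 'I_(2 * n + 1)}}])%fset.

(* h_L(mu|nu) ; mathcomp conventions ln 0 = 0, 0 * _ = 0 give 0 log 0 = 0 *)
Definition hL {R : realType} {E : finType} (plus : E) {d : nat}
  (L : {fset site d}) (mu nu : probability (Omega plus d) R) : R :=
  \sum_(s : {ffun L -> E})
     fine (mu (cyl plus s)) * ln (fine (mu (cyl plus s)) / fine (nu (cyl plus s))).

Definition h_seq {R : realType} {E : finType} (plus : E) {d : nat}
  (mu nu : probability (Omega plus d) R) (n : nat) : R :=
  ((#|` Lambda d n|)%fset%:R)^-1 * hL plus (Lambda d n) mu nu.

Definition eplus_seq {R : realType} {E : finType} (plus : E) {d : nat}
  (rho : probability (Omega plus d) R) (n : nat) : R :=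
  - (((#|` Lambda d n|)%fset%:R)^-1 * ln (fine (rho (cyl plus (plusL plus (Lambda d n)))))).

(* Main.v *)
Require Import Defs.
From HB Require Import structures.
From mathcomp Require Import all_boot all_order all_algebra finmap.
From mathcomp Require Import all_classical all_reals all_analysis measurable_realfun.
From mathcomp Require Import zify ring lra.

(** Writing [r_L(w)] for the [r]-probability of the cylinder [w_L], one has
    [h_L(a|nu) = int ln a_L da - int ln nu_L da].  Both terms are telescoped
    along the lexicographic order.

    For the first, the increments are conditional entropies of the origin given
    finitely many sites of its past; these decrease as the past grows, so their
    averages over the boxes converge: the entropy density exists.

    For the second, [ln nu_L(w) - ln nu_L(+)] is a sum over [x] in [L] of terms
    [ln (nu(w_{<=x} +_{>x}) / nu(w_{<x} +_{>=x}))].  After translation to the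
    origin such a term is a ratio of averages of the single-site kernel over the
    configurations that agree with [w^+] on [L - x] outside the origin.  When
    [w^+] is a continuity point of the kernel, these averages are determined up
    to a small error as soon as [L - x] is large, whatever the Gibbs measure.
    Hence [|Lambda_n|^-1 (int ln r_{Lambda_n} da - ln r_{Lambda_n}(+))] converges
    to a limit that depends on [a] but not on the invariant Gibbs measure [r].

    Taking [a = mu] and [r = mu, nu] gives (1); with the entropy density of [mu]
    it gives (2), and then the entropy density of [alpha] gives (3). *)

Set Implicit Arguments.
Unset Strict Implicit.
Unset Printing Implicit Defensive.
Import Order.TTheory GRing.Theory Num.Theory numFieldNormedType.Exports.
Local Open Scope classical_set_scope.
Local Open Scope ring_scope.

(** * Translations and the lexicographic order on Z^d *)

Definition sopp {d} (x : site d) : site d := [ffun i => - x i].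

Lemma sadd0 d (x : site d) : sadd x (site0 d) = x.
Proof. by apply/ffunP => i; rewrite !ffunE addr0. Qed.

Lemma saddC d (x y : site d) : sadd x y = sadd y x.
Proof. by apply/ffunP => i; rewrite !ffunE addrC. Qed.

Lemma saddA d (x y z : site d) : sadd x (sadd y z) = sadd (sadd x y) z.
Proof. by apply/ffunP => i; rewrite !ffunE addrA. Qed.

Lemma saddN d (x : site d) : sadd x (sopp x) = site0 d.
Proof. by apply/ffunP => i; rewrite !ffunE subrr. Qed.

Lemma saddNK d (x y : site d) : sadd x (sadd (sopp x) y) = y.
Proof. by rewrite saddA saddN saddC sadd0. Qed.

Lemma sadd_inj d (z : site d) : injective (sadd z).
Proof.
move=> x y /ffunP xy; apply/ffunP => i.
by have := xy i; rewrite !ffunE => /addrI.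
Qed.

Lemma mem_fshift d (L : {fset site d}) (x y : site d) :
  (y \in fshift L (sopp x)) = (sadd x y \in L).
Proof.
apply/imfsetP/idP => /= [[z zL ->]|h].
  by rewrite (saddC z) saddNK.
exists (sadd x y) => //; rewrite saddC saddA.
by rewrite [sadd (sopp x) x]saddC saddN saddC sadd0.
Qed.

Lemma soppK d (x : site d) : sopp (sopp x) = x.
Proof. by apply/ffunP => i; rewrite !ffunE opprK. Qed.

Lemma saddKN d (x y : site d) : sadd (sopp x) (sadd x y) = y.
Proof. by rewrite -{2}(soppK x) saddNK. Qed.

Lemma mem_fshiftD d (L : {fset site d}) (x y : site d) :
  (sadd x y \in fshift L x) = (y \in L).
Proof. by rewrite -{2}(soppK x) mem_fshift saddKN. Qed.

Lemma lex_ltxx d (x : site d) : lex_lt x x = false.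
Proof. by apply/existsP => -[i]; rewrite ltxx andbF. Qed.

Lemma lex_lt_trans d : transitive (@lex_lt d).
Proof.
move=> y x z /existsP[i /andP[/forallP hi xi]] /existsP[j /andP[/forallP hj yj]].
apply/existsP; have [ij|ji|ij] := ltngtP i j.
- exists i; apply/andP; split.
    apply/forallP => k; apply/implyP => ki.
    by rewrite (eqP (implyP (hi k) ki)) (eqP (implyP (hj k) (ltn_trans ki ij))).
  by rewrite (lt_le_trans xi)// (eqP (implyP (hj i) ij)).
- exists j; apply/andP; split.
    apply/forallP => k; apply/implyP => kj.
    by rewrite (eqP (implyP (hi k) (ltn_trans kj ji))) (eqP (implyP (hj k) kj)).
  by rewrite (eqP (implyP (hi j) ji)).
- move/val_inj : ij => ?; subst j; exists i; apply/andP; split.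
    apply/forallP => k; apply/implyP => ki.
    by rewrite (eqP (implyP (hi k) ki)) (eqP (implyP (hj k) ki)).
  exact: lt_trans xi yj.
Qed.

Lemma lex_lt_total d (x y : site d) : x != y -> lex_lt x y || lex_lt y x.
Proof.
move=> xy.
have /existsP[i0 hi0] : [exists i, x i != y i].
  apply: contraNT xy; rewrite negb_exists => /forallP h.
  by apply/eqP/ffunP => i; apply/eqP; have := h i; rewrite negbK.
have [i hi imin] := @arg_minnP _ i0 (fun i => x i != y i) (@nat_of_ord d) hi0.
have eqj (j : 'I_d) : (j < i)%N -> x j == y j.
  by move=> ji; apply: contraLR ji => /imin; rewrite -leqNgt.
have [lt|lt|/eqP eq] := ltgtP (x i) (y i); last by rewrite eq in hi.
- apply/orP; left; apply/existsP; exists i; rewrite lt andbT.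
  by apply/forallP => j; apply/implyP; exact: eqj.
- apply/orP; right; apply/existsP; exists i; rewrite lt andbT.
  by apply/forallP => j; apply/implyP => /eqj; rewrite eq_sym.
Qed.

Lemma lex_lt_add2l d (z x y : site d) : lex_lt (sadd z x) (sadd z y) = lex_lt x y.
Proof.
apply: eq_existsb => i; congr (_ && _); last by rewrite !ffunE ltrD2l.
by apply: eq_forallb => j; rewrite !ffunE (inj_eq (addrI _)).
Qed.

(** * Telescoping over a finite set along a strict total order *)

Lemma fset_maximal (T : choiceType) (lt : rel T) (L : {fset T}) :
  irreflexive lt -> transitive lt -> L != fset0 ->
  exists2 m, m \in L & {in L, forall y, ~~ lt m y}.
Proof.
move=> irr tr; elim/finSet_rect: L => L IH L0.
have /fset0Pn[x xL] := L0.
have [] := boolP [exists y : L, lt x (val y)]; last first.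
  rewrite negb_exists => /forallP h; exists x => // y yL.
  exact: (h [` yL]%fset).
case/existsP => y xy.
(* By transitivity, a maximal element among those above [x] is maximal in all of [L]. *)
have [||m mK hm] := IH [fset z in L | lt x z]%fset.
- rewrite fproperE; apply/andP; split.
    by apply/fsubsetP => z; rewrite !inE => /andP[].
  by apply/fsubsetPn; exists x => //; rewrite !inE irr andbF.
- by apply/fset0Pn; exists (val y); rewrite !inE xy fsvalP.
move: mK; rewrite !inE => /andP[mL xm]; exists m => // z zL.
apply/negP => mz; have := hm z; rewrite !inE zL /= (tr _ _ _ xm mz) mz.
by move/(_ isT).
Qed.

(** Induction on [L]: its largest element [m] contributes the increment from [L] without [m] to [L].
    For [x] below [m] neither set in the summand contains [m], so the other terms are those of [L]
    without [m]. *)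
Lemma telescope_fset (V : zmodType) (T : choiceType) (lt : rel T)
    (Phi : {fset T} -> V) (L : {fset T}) :
  irreflexive lt -> transitive lt ->
  (forall x y, x != y -> lt x y || lt y x) ->
  \sum_(x <- L) (Phi [fset y in L | ~~ lt x y]%fset - Phi [fset y in L | lt y x]%fset)
  = Phi L - Phi fset0.
Proof.
move=> irr tr tot; elim/finSet_rect: L => L IH.
have [->|L0] := eqVneq L fset0; first by rewrite big_seq_fset0 subrr.
have [m mL hm] := fset_maximal irr tr L0.
have hm' y : y \in (L `\ m)%fset -> lt y m.
  rewrite !inE => /andP[ym yL]; have := tot _ _ ym.
  by rewrite (negbTE (hm _ yL)) orbF.
rewrite (big_fsetD1 m)//=.
have -> : [fset y in L | ~~ lt m y]%fset = L.
  by apply/fsetP => y; rewrite !inE; have [/hm->|] := boolP (y \in L).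
have -> : [fset y in L | lt y m]%fset = (L `\ m)%fset.
  apply/fsetP => y; rewrite !inE; have [->|ym]/= := eqVneq y m.
    by rewrite irr andbF.
  by have [yL/=|//] := boolP (y \in L); rewrite hm'// !inE ym.
rewrite -[RHS](subrKA (Phi (L `\ m)%fset)) -IH ?fproperD1//; congr (_ + _).
rewrite !big_seq; apply: eq_bigr => x xL; have xm := hm' _ xL; congr (Phi _ - Phi _).
- apply/fsetP => y; rewrite !inE; have [->|]//= := eqVneq y m.
  by rewrite xm andbF.
- apply/fsetP => y; rewrite !inE; have [->|]//= := eqVneq y m.
  apply/negbTE; rewrite negb_and; apply/orP; right; apply: contraT => /negPn mx.
  by have := tr _ _ _ xm mx; rewrite irr.
Qed.

(** * Boxes and averages over boxes *)

Lemma mem_Lambda d n (x : site d) :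
  (x \in Lambda d n) = [forall i, `|x i| <= n%:Z].
Proof.
apply/imfsetP/forallP => /= [[k _ ->] i|h].
  by rewrite ffunE; case: (k i) => j /= hj; rewrite ler_norml; lia.
have hk i : (absz (x i + n%:Z)%R < 2 * n + 1)%N.
  by have := h i; rewrite ler_norml; lia.
exists [ffun i => Ordinal (hk i)] => //; apply/ffunP => i; rewrite !ffunE /=.
by have := h i; rewrite ler_norml; lia.
Qed.

Lemma card_Lambda d n : #|` Lambda d n|%fset = ((2 * n + 1) ^ d)%N.
Proof.
rewrite card_imfset /=; last first.
  move=> k k' /ffunP kk'; apply/ffunP => i; apply: val_inj => /=.
  have := kk' i; rewrite !ffunE => /addIr/eqP; rewrite eqz_nat; exact/eqP.
rewrite -[RHS](_ : #|{: {ffun 'I_d -> 'I_(2 * n + 1)}}| = _)%N; last first.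
  by rewrite card_ffun !card_ord.
rewrite cardE; apply/eqP; rewrite -uniq_size_uniq ?enum_uniq ?enum_finmem_uniq//.
Qed.

Lemma Lambda_gt0 d n : (0 < #|` Lambda d n|%fset)%N.
Proof. by rewrite card_Lambda expn_gt0 addn1. Qed.

Lemma sub_Lambda d m n : (m <= n)%N -> (Lambda d m `<=` Lambda d n)%fset.
Proof.
move=> mn; apply/fsubsetP => x; rewrite !mem_Lambda => /forallP h.
by apply/forallP => i; rewrite (le_trans (h i))// lez_nat.
Qed.

Lemma site0_Lambda d n : site0 d \in Lambda d n.
Proof. by rewrite mem_Lambda; apply/forallP => i; rewrite ffunE normr0. Qed.

Lemma fset_sub_Lambda d (L : {fset site d}) : exists n, (L `<=` Lambda d n)%fset.
Proof.
exists (\max_(x <- L) \max_(i < d) `|x i|)%N; apply/fsubsetP => x xL.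
rewrite mem_Lambda; apply/forallP => i; rewrite -abszE lez_nat.
apply: (@leq_trans (\max_(i < d) `|x i|)%N); first exact: leq_bigmax.
by rewrite (big_fsetD1 x)//= leq_maxl.
Qed.

Lemma Lambda_sub_fshift d m n (x : site d) : (m <= n)%N -> x \in Lambda d (n - m) ->
  (Lambda d m `<=` fshift (Lambda d n) (sopp x))%fset.
Proof.
move=> mn; rewrite mem_Lambda => /forallP hx.
apply/fsubsetP => y; rewrite mem_Lambda mem_fshift mem_Lambda => /forallP hy.
apply/forallP => i; rewrite ffunE; have := hx i; have := hy i.
by rewrite !ler_norml; lia.
Qed.

(** For [n >= m] the ratio equals [1 - (1 - 2m/(2n+1))^d], and [harmonic (2 * n)] is [1/(2n+1)]. *)
Lemma Lambda_boundary_cvg (R : realType) d m :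
  (fun n => ((#|` Lambda d n|%fset - #|` Lambda d (n - m)|%fset)%N)%:R /
     (#|` Lambda d n|%fset)%:R) @ \oo --> (0 : R).
Proof.
have -> : (0 : R) = 1 - (1 - 2 * m%:R * 0) ^+ d by rewrite mulr0 subr0 expr1n subrr.
have h : (fun n => 1 - (1 - 2 * m%:R * harmonic (2 * n)%N) ^+ d : R) @ \oo -->
    (1 - (1 - 2 * m%:R * 0) ^+ d : R).
  apply: cvgB; first exact: cvg_cst.
  apply: (@continuous_cvg _ _ _ _ _ _ (fun x : R => x ^+ d)); first exact: exprn_continuous.
  apply: cvgB; first exact: cvg_cst.
  apply: cvgMr.
  apply: (@cvg_comp _ _ _ (fun n => 2 * n)%N (@harmonic R) \oo \oo); last exact: cvg_harmonic.
  apply/cvgnyPge => A; near=> n.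
  have : (A <= n)%N by near: n; exact: nbhs_infty_ge.
  by move/leq_trans; apply; rewrite leq_pmull.
move: h; apply: cvg_trans; apply: near_eq_cvg; near=> n.
have mn : (m <= n)%N by near: n; exact: nbhs_infty_ge.
have L0 : (#|` Lambda d n|%fset)%:R != 0 :> R by rewrite pnatr_eq0 -lt0n Lambda_gt0.
rewrite natrB; last by rewrite fsubset_leq_card// sub_Lambda// leq_subr.
rewrite mulrBl divff// !card_Lambda !natrX -exprVn -exprMn; congr (1 - _ ^+ _).
have n0 : (2 * n + 1)%:R != 0 :> R by rewrite pnatr_eq0; lia.
have -> : harmonic (2 * n)%N = (2 * n + 1)%:R^-1 :> R by rewrite /harmonic/= addn1.
apply: (mulIf n0); rewrite mulrBl !mulfVK// mul1r -natrM -natrB; last by lia.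
by congr (_%:R); lia.
Unshelve. all: by end_near. Qed.

(** For [x] in [Lambda d (n - m)] the box translated by [-x] contains [Lambda d m], so its term is
    within [e / 2] of [l]. The remaining sites have vanishing density and each costs at most
    [B + |l|]. *)
Lemma Lambda_average_cvg (R : realType) d (F : {fset site d} -> R) (B l : R) :
  (forall L, site0 d \in L -> `|F L| <= B) ->
  (forall e, 0 < e -> exists m, forall L, (Lambda d m `<=` L)%fset -> `|F L - l| <= e) ->
  (fun n => (#|` Lambda d n|%fset)%:R^-1 *
     \sum_(x <- Lambda d n) F (fshift (Lambda d n) (sopp x))) @ \oo --> l.
Proof.
move=> FB Fl; apply/cvgrPdist_le => /= e e0.
have e20 : 0 < e / 2 by rewrite divr_gt0.
have [m hm] := Fl _ e20.
(* The summand 1 keeps this divisor positive even when [B] and [l] vanish. *)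
have B0 : 0 < B + `|l| + 1.
  by rewrite ltr_wpDl// addr_ge0// (le_trans _ (FB [fset site0 d]%fset _))// inE.
have := @Lambda_boundary_cvg R d m => /cvgrPdist_le /(_ (e / 2 / (B + `|l| + 1))).
rewrite divr_gt0// => /(_ isT) bnd.
near=> n.
have mn : (m <= n)%N by near: n; exact: nbhs_infty_ge.
have L0 : 0 < (#|` Lambda d n|%fset)%:R :> R by rewrite ltr0n Lambda_gt0.
have sLL : (Lambda d (n - m) `<=` Lambda d n)%fset by rewrite sub_Lambda// leq_subr.
have -> : l = (#|` Lambda d n|%fset)%:R^-1 * \sum_(x <- Lambda d n) l.
  by rewrite big_const_seq count_predT iter_addr_0 -[l *+ _]mulr_natl mulKf// gt_eqF.
rewrite -mulrBr -sumrB normrM gtr0_norm ?invr_gt0// mulrC ler_pdivrMr//.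
apply: (le_trans (ler_norm_sum _ _ _)).
rewrite (big_fsetID _ (mem (Lambda d (n - m))))/=.
have -> : e * (#|` Lambda d n|%fset)%:R = e / 2 * (#|` Lambda d n|%fset)%:R
  + e / 2 * (#|` Lambda d n|%fset)%:R by rewrite -mulrDl -splitr.
apply: lerD.
  apply: (@le_trans _ _ (\sum_(x <- [fset x in Lambda d n | x \in Lambda d (n - m)]%fset) (e / 2))).
    rewrite !big_seq; apply: ler_sum => x; rewrite !inE => /andP[_ xn].
    by rewrite distrC; apply: hm; exact: Lambda_sub_fshift.
  rewrite big_const_seq count_predT iter_addr_0 -[e / 2 *+ _]mulr_natr ler_pM2l// ler_nat.
  by rewrite fsubset_leq_card//; apply/fsubsetP => x; rewrite !inE => /andP[].
apply: (@le_trans _ _ (\sum_(x <- [fset x in Lambda d n | x \notin Lambda d (n - m)]%fset)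
    (B + `|l| + 1))).
  rewrite !big_seq; apply: ler_sum => x; rewrite !inE => /andP[xn _].
  have := FB (fshift (Lambda d n) (sopp x)); rewrite mem_fshift sadd0 => /(_ xn) h.
  by rewrite (le_trans (ler_normB _ _))// addrC; lra.
rewrite big_const_seq count_predT iter_addr_0 -[(_ + 1) *+ _]mulr_natr.
have -> : size [fset x in Lambda d n | x \notin Lambda d (n - m)]%fset =
    (#|` Lambda d n| - #|` Lambda d (n - m)|)%fset%N.
  rewrite -(cardfsDS sLL); congr (#|` _|)%fset.
  by apply/fsetP => x; rewrite !inE andbC.
have : `|0 - ((#|` Lambda d n|%fset - #|` Lambda d (n - m)|%fset)%N)%:R /
     (#|` Lambda d n|%fset)%:R| <= e / 2 / (B + `|l| + 1) by near: n; exact: bnd.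
rewrite sub0r normrN ger0_norm ?divr_ge0// ler_pdivlMr// mulrC mulrA.
by rewrite ler_pdivrMr.
Unshelve. all: by end_near. Qed.

(** * Cylinders and functions of finitely many coordinates *)

Section cylinders.
Context (E : finType) (plus : E) (d : nat).
Local Notation Om := (Omega plus d).
Implicit Types (w : Om) (L : {fset site d}) (x : site d).

Definition ext L (s : {ffun L -> E}) : Om :=
  fun x => if insub x is Some y then s y else plus.

Definition restr L w : {ffun L -> E} := [ffun x => w (fsval x)].

(** Cylinders are indexed by a whole configuration rather than by a pattern on [L], so that
    translating [L] or changing one spin needs no transport between pattern types. *)
Definition box L w : set Om := [set w' | forall x, x \in L -> w' x = w x].

Definition upd w x e : Om := fun y => if y == x then e else w y.

Definition depends_on (T : Type) L (f : Om -> T) :=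
  forall w w', (forall x, x \in L -> w x = w' x) -> f w = f w'.

Lemma extE L (s : {ffun L -> E}) (x : L) : ext s (fsval x) = s x.
Proof. by rewrite /ext (valK x). Qed.

Lemma restrK L (w : Om) x : x \in L -> ext (restr L w) x = w x.
Proof. by move=> xL; rewrite (extE _ [` xL]%fset) ffunE. Qed.

Lemma cylE L (s : {ffun L -> E}) : cyl plus s = box L (ext s).
Proof.
apply/seteqP; split=> w /= h x; last by rewrite (h _ (fsvalP x)) extE.
by move=> xL; rewrite (h [` xL]%fset) (extE _ [` xL]%fset).
Qed.

Lemma boxE L w : box L w = cyl plus (restr L w).
Proof.
rewrite cylE; apply/seteqP; split=> w' /= h x xL; rewrite h//.
  by rewrite restrK.
by rewrite restrK.
Qed.

Lemma in_cyl L (s : {ffun L -> E}) w : (w \in cyl plus s) = (restr L w == s).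
Proof.
apply/idP/eqP => [/set_mem h|<-].
  by apply/ffunP => x; rewrite ffunE h.
by apply/mem_set; rewrite -boxE.
Qed.

Lemma FD_box (D : set (site d)) L w : [set` L] `<=` D -> FD plus D (box L w).
Proof.
move=> LD.
have -> : box L w = \bigcap_(x in [set` L]) [set w' : Om | w' x = w x].
  by apply/seteqP; split.
apply: (@fin_bigcap_measurable _ (g_sigma_algebraType (coordG plus D))) => // x xL.
by apply: sub_gen_smallest; exists x, (w x); split => //; exact: LD.
Qed.

Lemma measurable_box L w : measurable (box L w).
Proof. exact: (@FD_box setT). Qed.

Lemma measurable_cyl L (s : {ffun L -> E}) : measurable (cyl plus s : set Om).
Proof. by rewrite cylE; exact: measurable_box. Qed.

Lemma measurable_coord x e : measurable [set w : Om | w x = e].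
Proof. by apply: sub_gen_smallest; exists x, e. Qed.

(** The sets that do not separate configurations agreeing on [D] form a sigma-algebra containing the
    coordinate events of [D]. *)
Lemma FD_saturated (D : set (site d)) (A : set Om) w w' :
  FD plus D A -> agree plus D w w' -> A w -> A w'.
Proof.
move=> FA ww'.
(* As an equivalence, the claim passes directly to complements. *)
suff : A w <-> A w' by case.
move: A FA w w' ww'; apply: smallest_sub => //.
  split=> [//|A hA w w' /hA|F hF w w' ww'].
    by rewrite /setD/= => -[h1 h2]; split=> -[_ h]; split=> //; tauto.
  by split=> -[i _ Fi]; exists i => //; apply/(hF i w w' ww').
by move=> A [x [e [Dx ->]]] w w' /(_ x Dx)/= ->.
Qed.

Lemma FD_fun_depends (D : set (site d)) (T : Type) (F : Om -> T) :
  (forall w, FD plus D (F @^-1` [set F w])) ->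
  forall w w', agree plus D w w' -> F w = F w'.
Proof.
move=> FF w w' ww'; apply: esym.
exact: (FD_saturated (FF w) ww').
Qed.

(** Exactly one cylinder over [L] contains [w]. This turns integrals of such functions into finite
    sums. *)
Lemma sum_cyl (R : pzRingType) L (f : Om -> R) w : depends_on L f ->
  f w = \sum_(s : {ffun L -> E}) f (ext s) * \1_(cyl plus s) w.
Proof.
move=> fL; rewrite (bigD1 (restr L w))//= big1 => [|s sw].
  rewrite addr0 indicE in_cyl eqxx mulr1; apply: fL => x xL.
  by rewrite restrK.
by rewrite indicE in_cyl eq_sym (negbTE sw) mulr0.
Qed.

Lemma depends_onS (T : Type) L L' (f : Om -> T) :
  (L `<=` L')%fset -> depends_on L f -> depends_on L' f.
Proof.
by move=> LL' fL w w' ww'; apply: fL => x xL; apply: ww'; exact: (fsubsetP LL').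
Qed.

Lemma box_upd L w x e : x \notin L ->
  box (x |` L)%fset (upd w x e) = box L w `&` [set w' | w' x = e].
Proof.
move=> xL; apply/seteqP; split=> w' /=.
  move=> h; split=> [y yL|]; last by rewrite h ?fset1U1// /upd eqxx.
  rewrite h ?fset1Ur// /upd; case: eqP => // yx.
  by rewrite yx (negbTE xL) in yL.
move=> [h he] y; rewrite !inE => /orP[/eqP->|yL]; first by rewrite /upd eqxx.
rewrite /upd; case: eqP => [->//|_]; exact: h.
Qed.

Lemma tau_box L x w :
  tau plus x @^-1` box (fshift L (sopp x)) (tau plus x w) = box L w.
Proof.
apply/seteqP; split=> w' /= h y.
  move=> yL; have := h (sadd (sopp x) y).
  by rewrite mem_fshift saddNK /tau saddNK; apply.
by rewrite mem_fshift /tau => /h.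
Qed.

Lemma tau_preimage_box L x w :
  tau plus x @^-1` box L w = box (fshift L x) (tau plus (sopp x) w).
Proof.
rewrite -(tau_box (fshift L x) x); congr (_ @^-1` _).
have -> : fshift (fshift L x) (sopp x) = L.
  by apply/fsetP => y; rewrite mem_fshift mem_fshiftD.
by congr box; apply/funext => y; rewrite /tau saddKN.
Qed.

End cylinders.

(** * Marginals and integrals of local functions *)

Section expectation.
Context (R : realType) (E : finType) (plus : E) (d : nat).
Local Notation Om := (Omega plus d).
Implicit Types (w : Om) (L : {fset site d}) (x : site d) (a : probability Om R).

Definition marg a L w : R := fine (a (box L w)).

(** Since [E] is finite, such a function takes finitely many values, so measurability and
    integrability are automatic. *)
Definition local (f : Om -> R) := exists L, depends_on L f.

Lemma fine_probabilityK (a : probability Om R) (A : set Om) : measurable A ->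
  (fine (a A))%:E = a A.
Proof. by move=> mA; rewrite fineK// fin_num_measure. Qed.

Lemma integrable_indic (a : probability Om R) (A : set Om) (c : R) : measurable A ->
  a.-integrable setT (EFin \o (fun w => c * \1_A w)).
Proof.
move=> mA; have -> : EFin \o (fun w => c * \1_A w) = (fun w => c%:E * (\1_A w)%:E)%E.
  by apply/funext => w /=; rewrite EFinM.
apply: integrableZl => //.
apply/integrableP; split; first exact/measurable_EFinP/measurable_indic.
under eq_integral do rewrite gee0_abs ?lee_fin//.
rewrite integral_indic// setIT; apply: (le_lt_trans (probability_le1 a mA)).
exact: ltry.
Qed.

Lemma integrable_simple a (I : finType) (c : I -> R) (A : I -> set Om) :
  (forall i, measurable (A i)) ->
  a.-integrable setT (EFin \o (fun w => \sum_i c i * \1_(A i) w)).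
Proof.
move=> mA; have -> : EFin \o (fun w => \sum_i c i * \1_(A i) w) =
    (fun w => \sum_i (EFin \o (fun w => (c i * \1_(A i) w)%R)) w)%E.
  by apply/funext => w /=; rewrite sumEFin.
by apply: integrable_sum => // i _; exact: integrable_indic.
Qed.

Lemma Rintegral_simple a (I : finType) (c : I -> R) (A : I -> set Om) :
  (forall i, measurable (A i)) ->
  \int[a]_w (\sum_i c i * \1_(A i) w) = \sum_i c i * fine (a (A i)).
Proof.
move=> mA; rewrite /Rintegral.
under eq_integral do rewrite -sumEFin.
rewrite integral_sum//; last by move=> i; exact: integrable_indic.
rewrite (eq_bigr (fun i => (c i * fine (a (A i)))%:E)) ?sumEFin// => i _.
under eq_integral do rewrite EFinM.
rewrite integralZl//; last first.
  have := integrable_indic a 1 (mA i).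
  by under [X in EFin \o X]eq_fun do rewrite mul1r.
by rewrite integral_indic// setIT EFinM fine_probabilityK.
Qed.

Lemma Rintegral_depends_indic a L (f : Om -> R) (A : set Om) :
  depends_on L f -> measurable A ->
  \int[a]_w (f w * \1_A w) =
  \sum_(s : {ffun L -> E}) f (ext plus s) * fine (a (cyl plus s `&` A)).
Proof.
move=> fL mA; rewrite -Rintegral_simple.
  by apply: eq_Rintegral => w _; rewrite (sum_cyl w fL) mulr_suml;
    apply: eq_bigr => s _; rewrite indicI/= mulrA.
by move=> s; apply: measurableI => //; exact: measurable_cyl.
Qed.

Lemma Rintegral_depends a L (f : Om -> R) : depends_on L f ->
  \int[a]_w f w = \sum_(s : {ffun L -> E}) f (ext plus s) * marg a L (ext plus s).
Proof.
move=> fL; have := Rintegral_depends_indic a fL (@measurableT _ Om).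
under eq_Rintegral do rewrite indicT mulr1.
by move=> ->; apply: eq_bigr => s _; rewrite setIT /marg -cylE.
Qed.

Lemma local_integrable a f : local f -> a.-integrable setT (EFin \o f).
Proof.
move=> [L fL]; have -> : f = fun w => \sum_(s : {ffun L -> E}) f (ext plus s) * \1_(cyl plus s) w.
  by apply/funext => w; exact: sum_cyl.
by apply: integrable_simple => s; exact: measurable_cyl.
Qed.

Lemma local2 (op : R -> R -> R) f g : local f -> local g ->
  local (fun w => op (f w) (g w)).
Proof.
move=> [L fL] [L' gL']; exists (L `|` L')%fset => w w' ww'; congr op.
  by apply: fL => x xL; apply: ww'; rewrite inE xL.
by apply: gL' => x xL; apply: ww'; rewrite inE xL orbT.
Qed.

Lemma local1 (op : R -> R) f : local f -> local (fun w => op (f w)).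
Proof. by move=> [L fL]; exists L => w w' ww'; congr op; exact: fL. Qed.

Lemma local_cst (c : R) : local (fun=> c).
Proof. by exists fset0. Qed.

Lemma local_sum (I : Type) (r : seq I) (F : I -> Om -> R) :
  (forall i, local (F i)) -> local (fun w => \sum_(i <- r) F i w).
Proof.
move=> lF; elim: r => [|i r IH].
  by under eq_fun do rewrite big_nil; exact: local_cst.
by under eq_fun do rewrite big_cons; exact: local2.
Qed.

Lemma Rintegral_sum a (I : Type) (r : seq I) (F : I -> Om -> R) :
  (forall i, local (F i)) ->
  \int[a]_w (\sum_(i <- r) F i w) = \sum_(i <- r) \int[a]_w F i w.
Proof.
move=> lF; elim: r => [|i r IH].
  under eq_Rintegral do rewrite big_nil.
  by rewrite big_nil Rintegral_cst// mul0r.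
under eq_Rintegral do rewrite big_cons.
rewrite RintegralD//= ?big_cons ?IH//; apply: local_integrable => //.
exact: local_sum.
Qed.

Lemma Rintegral_prob_cst a (c : R) : \int[a]_w c = c.
Proof. by rewrite Rintegral_cst//= probability_setT mulr1. Qed.

Lemma Rintegral_tau a f x : translation_invariant plus a -> local f ->
  \int[a]_w f (tau plus x w) = \int[a]_w f w.
Proof.
move=> ta [L fL]; rewrite (Rintegral_depends a fL).
transitivity (\int[a]_w \sum_(s : {ffun L -> E}) f (ext plus s) * \1_(tau plus x @^-1` cyl plus s) w).
  by apply: eq_Rintegral => w _; rewrite (sum_cyl _ fL).
rewrite Rintegral_simple => [|s].
  by apply: eq_bigr => s _; rewrite ta ?cylE//; exact: measurable_box.
by rewrite cylE tau_preimage_box; exact: measurable_box.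
Qed.

Lemma marg_ge0 a L w : 0 <= marg a L w.
Proof. by rewrite /marg fine_ge0. Qed.

Lemma depends_marg a L : depends_on L (marg a L).
Proof.
move=> w w' ww'; rewrite /marg; congr (fine (a _)).
by apply/seteqP; split=> v /= h x xL; rewrite h// ww'.
Qed.

Lemma local_marg a L : local (marg a L).
Proof. by exists L; exact: depends_marg. Qed.

Lemma marg_anti a L L' w : (L `<=` L')%fset -> marg a L' w <= marg a L w.
Proof.
move=> LL'; rewrite -lee_fin !fine_probabilityK; try exact: measurable_box.
apply: le_measure; rewrite ?inE; try exact: measurable_box.
by move=> v /= h x /(fsubsetP LL'); exact: h.
Qed.

Lemma marg0 a w : marg a fset0 w = 1.
Proof.
rewrite /marg; have -> : box fset0 w = setT by apply/seteqP; split => v.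
by rewrite probability_setT.
Qed.

Lemma marg_tau a L x w : translation_invariant plus a ->
  marg a (fshift L (sopp x)) (tau plus x w) = marg a L w.
Proof.
move=> ta; rewrite /marg -(ta x); last exact: measurable_box.
by rewrite tau_box.
Qed.

Lemma upd_id w x : upd w x (w x) = w.
Proof. by apply/funext => y; rewrite /upd; case: eqP => [->|]. Qed.

Lemma marg_split a L x w : x \notin L ->
  \sum_(e : E) marg a (x |` L)%fset (upd w x e) = marg a L w.
Proof.
move=> xL; have mx := @measurable_coord E plus d x.
have -> : marg a L w = \int[a]_v \1_(box L w) v.
  by rewrite /Rintegral integral_indic ?setIT//; exact: measurable_box.
under eq_Rintegral => v _.
  rewrite (_ : \1_(box L w) v = \sum_(e : E) 1 * \1_(box L w `&` [set w' | w' x = e]) v).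
    over.
  rewrite (bigD1 (v x))//= big1 => [|e ev].
    by rewrite addr0 mul1r indicI /= [X in _ * X]indicE mem_set// mulr1.
  by rewrite mul1r indicI/= [X in _ * X]indicE memNset ?mulr0//= => /eqP; rewrite eq_sym (negbTE ev).
rewrite Rintegral_simple => [|e].
  by apply: eq_bigr => e _; rewrite mul1r /marg box_upd.
by apply: measurableI => //; exact: measurable_box.
Qed.

(** On each cylinder over [L] the function [h] is constant, so the indicator may be replaced by its
    conditional probability given the spins in [L]. *)
Lemma Rintegral_condition a L x e (h : Om -> R) : x \notin L -> depends_on L h ->
  \int[a]_w (h w * \1_[set w' | w' x = e] w) =
  \int[a]_w (h w * (marg a (x |` L)%fset (upd w x e) / marg a L w)).
Proof.
move=> xL hL.
have mx := @measurable_coord E plus d x e.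
rewrite (Rintegral_depends_indic a hL)// (@Rintegral_depends a L); last first.
  move=> w w' ww'; congr (_ * (_ / _)); [exact: hL| |exact: depends_marg].
  apply: depends_marg => y; rewrite !inE /upd => /orP[/eqP->|/ww' ->//].
  by rewrite eqxx.
apply: eq_bigr => s _; rewrite -mulrA; congr (_ * _).
rewrite cylE -box_upd// -/(marg a _ _).
(* On a null cylinder the ratio has the default value 0, which is harmless because the smaller
   cylinder is null as well. *)
have [m0|m0] := eqVneq (marg a L (ext plus s)) 0; last by rewrite divfK.
rewrite m0 mulr0; apply/eqP; rewrite eq_le marg_ge0 andbT.
rewrite -m0; apply: (le_trans (marg_anti a (upd (ext plus s) x e) (fsubsetU1 x L))).
rewrite (@depends_marg a L _ (ext plus s))// => y yL; rewrite /upd; case: eqP => // yx.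
by rewrite -yx yL in xL.
Qed.

Lemma Rintegral_marg_eq0 a L : \int[a]_w (marg a L w == 0)%:R = 0 :> R.
Proof.
rewrite (@Rintegral_depends a L); last by move=> w w' ww'; rewrite (depends_marg a ww').
by rewrite big1// => s _; case: eqP => [->|_]; rewrite ?mulr0 ?mul0r.
Qed.

End expectation.

(** * Conditional entropies and the entropy density *)

Section entropy.
Context (R : realType) (E : finType) (plus : E) (d : nat).
Local Notation Om := (Omega plus d).
Variable a : probability Om R.
Implicit Types (w : Om) (K L : {fset site d}) (x : site d).

Definition condp K x w : R := marg a (x |` K)%fset w / marg a K w.

Definition cond_entropy K x : R := - \int[a]_w ln (condp K x w).

Definition past L : {fset site d} := [fset y in L | lex_lt y (site0 d)]%fset.

Lemma condp_ge0 K x w : 0 <= condp K x w.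
Proof. by rewrite divr_ge0 ?marg_ge0. Qed.

Lemma condp_le1 K x w : condp K x w <= 1.
Proof.
have [m0|m0] := eqVneq (marg a K w) 0; first by rewrite /condp m0 invr0 mulr0.
have mp : 0 < marg a K w by rewrite lt_def m0 marg_ge0.
by rewrite ler_pdivrMr// mul1r marg_anti// fsubsetU1.
Qed.

Lemma condp_eq0 K x w : (condp K x w == 0) = (marg a (x |` K)%fset w == 0).
Proof.
rewrite mulf_eq0 invr_eq0 orb_idr// => /eqP m0; rewrite eq_le marg_ge0 andbT.
by rewrite -m0 marg_anti// fsubsetU1.
Qed.

Lemma local_condp K x : local (condp K x).
Proof. by apply: (@local2 _ _ _ _ (fun u v => u / v)); exact: local_marg. Qed.

Lemma local_ln_condp K x : local (fun w => ln (condp K x w)).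
Proof. exact/local1/local_condp. Qed.

Lemma local_indic x e : local (fun w => \1_[set w' : Om | w' x = e] w : R).
Proof.
exists [fset x]%fset => w w' ww'; rewrite !indicE; congr (_%:R); congr nat_of_bool.
by apply/idP/idP => /set_mem/= h; apply/mem_set => /=; rewrite -h ww' // inE.
Qed.

Lemma depends_marg_upd K x e :
  depends_on K (fun w => marg a (x |` K)%fset (upd w x e)).
Proof.
move=> w w' ww'; apply: depends_marg => y; rewrite !inE /upd.
by case: (y == x) => //= /ww'.
Qed.

(** Given the spins in [K'], the denominator is the probability of the spin observed at [x].
    Averaging over that spin cancels it and leaves a sum over spins of conditional probabilities
    given [K]. *)
Lemma Rintegral_condp_ratio K K' x : (K `<=` K')%fset -> x \notin K' ->
  \int[a]_w (condp K x w / condp K' x w) <= 1.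
Proof.
move=> KK' xK'; have xK : x \notin K by apply: contra xK'; exact: (fsubsetP KK').
(* This is [condp] with the spin at [x] set to [e]; it depends on the conditioning sites only, so
   that [Rintegral_condition] applies. *)
pose r (K : {fset site d}) e w := marg a (x |` K)%fset (upd w x e) / marg a K w.
have r_ge0 L e w : 0 <= r L e w by rewrite divr_ge0 ?marg_ge0.
have rL L e : depends_on L (r L e).
  move=> w w' ww'; congr (_ / _); last exact: depends_marg.
  exact: (@depends_marg_upd L x e w w').
have hL e : depends_on K' (fun w => r K e w / r K' e w).
  move=> w w' ww'; congr (_ / _); last exact: (rL K').
  exact: (depends_onS KK' (rL K e)).
have lr e : local (r K e) by exists K.
have lh e : local (fun w => r K e w / r K' e w * r K' e w).
  by exists K' => w w' ww'; congr (_ * _); [exact: (hL e)|exact: rL].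
under eq_Rintegral => w _.
  rewrite (_ : condp K x w / condp K' x w =
      \sum_(e : E) (r K e w / r K' e w) * \1_[set w' : Om | w' x = e] w); first over.
  rewrite (bigD1 (w x))//= big1 => [|e ev].
    by rewrite addr0 indicE mem_set// mulr1 /r upd_id.
  by rewrite indicE memNset ?mulr0//= => /eqP; rewrite eq_sym (negbTE ev).
rewrite Rintegral_sum; last first.
  move=> e; apply: (@local2 _ _ _ _ (fun u v => u * v)); first by exists K'.
  exact: local_indic.
under eq_bigr => e _ do rewrite (Rintegral_condition a e xK' (hL e)).
rewrite -[leRHS](Rintegral_prob_cst a).
apply: (@le_trans _ _ (\sum_e \int[a]_w r K e w)).
  apply: ler_sum => e _; apply: le_Rintegral => //; [exact: local_integrable..|].
  (* Where [r K' e w] vanishes the product to be cancelled is 0, hence an inequality and not an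
     equality. *)
  move=> w _; have [r0|r0] := eqVneq (r K' e w) 0; last by rewrite divfK.
  by rewrite -/(r K' e w) r0 mulr0.
rewrite -Rintegral_sum//; apply: le_Rintegral => //.
- by apply: local_integrable; exact: local_sum.
- by apply: local_integrable; exact: local_cst.
move=> w _; rewrite -mulr_suml marg_split//.
by have [->|m0] := eqVneq (marg a K w) 0; rewrite ?mul0r// divff.
Qed.

(** This is [ln t <= t - 1] at [t = p / q]. For [q = 0] the conventions [ln 0 = 0] and [p / 0 = 0]
    make the left side 0 and the right side [- ln p], which is nonnegative since [p <= 1]. *)
Lemma ln_ratio_ge (p q : R) : 0 <= q -> 0 <= p -> p <= 1 -> (p = 0 -> q = 0) ->
  (q != 0)%:R - p / q <= ln q - ln p.
Proof.
move=> q0 p0 p1 pq; have [->|qn0] := eqVneq q 0.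
  by rewrite invr0 mulr0 subr0 /= (ln0 (lexx 0)) sub0r oppr_ge0 ln_le0.
have qp : 0 < q by rewrite lt_def qn0.
have pp : 0 < p by rewrite lt_def p0 andbT; apply: contra_neq qn0.
have t0 : 0 < p / q by rewrite divr_gt0.
have : ln (1 + (p / q - 1)) <= p / q - 1 by apply: le_ln1Dx; lra.
rewrite addrC subrK ln_div ?posrE//=; lra.
Qed.

(** By [ln_ratio_ge] the difference is at least the integral of the indicator of
    [condp K' x w != 0], which is 1, minus the integral of a ratio, which is at most 1. *)
Lemma cond_entropy_anti K K' x : (K `<=` K')%fset -> x \notin K' ->
  cond_entropy K' x <= cond_entropy K x.
Proof.
move=> KK' xK'; rewrite /cond_entropy lerN2 -subr_ge0.
rewrite -RintegralB//; try exact/local_integrable/local_ln_condp.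
have l0 : local (fun w => (marg a (x |` K')%fset w == 0)%:R : R).
  by apply: (@local1 _ _ _ _ (fun u => (u == 0)%:R)); exact: local_marg.
have lr : local (fun w => condp K x w / condp K' x w).
  by apply: (@local2 _ _ _ _ (fun u v => u / v)); exact: local_condp.
have l1 : local (fun w => 1 - (marg a (x |` K')%fset w == 0)%:R : R).
  by apply: (@local2 _ _ _ _ (fun u v => u - v)) => //; exact: local_cst.
apply: (@le_trans _ _ (\int[a]_w ((1 - (marg a (x |` K')%fset w == 0)%:R)
    - condp K x w / condp K' x w))).
  rewrite RintegralB//; [|exact: local_integrable..].
  rewrite RintegralB//; [|by apply: local_integrable; exact: local_cst|exact: local_integrable].
  rewrite Rintegral_prob_cst Rintegral_marg_eq0 subr0 subr_ge0.
  exact: Rintegral_condp_ratio.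
apply: le_Rintegral => //.
- by apply: local_integrable; apply: (@local2 _ _ _ _ (fun u v => u - v)).
- apply: local_integrable; apply: (@local2 _ _ _ _ (fun u v => u - v)); exact: local_ln_condp.
move=> w _; rewrite -condp_eq0.
have -> : 1 - (condp K' x w == 0)%:R = (condp K' x w != 0)%:R :> R.
  by case: eqP => _; rewrite ?subrr ?subr0.
apply: ln_ratio_ge; rewrite ?condp_ge0 ?condp_le1// => /eqP; rewrite condp_eq0 => /eqP m0.
apply/eqP; rewrite condp_eq0 eq_le marg_ge0 andbT -m0 marg_anti//.
exact: fsetUS.
Qed.

Lemma cond_entropy_ge0 K x : 0 <= cond_entropy K x.
Proof.
rewrite oppr_ge0 -oppr_ge0 -[X in 0 <= - X]mul1r -mulNr -RintegralZl//; last first.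
  exact/local_integrable/local_ln_condp.
by apply: Rintegral_ge0 => w _; rewrite mulN1r oppr_ge0 ln_le0// condp_le1.
Qed.

(** The logarithm of the quotient splits on every cylinder over [K] and [x] of positive mass; null
    cylinders carry weight 0, so the default values there do not matter. *)
Lemma cond_entropy_chain K x :
  \int[a]_w ln (marg a (x |` K)%fset w) - \int[a]_w ln (marg a K w) = - cond_entropy K x.
Proof.
have l1 L : local (fun w => ln (marg a L w)) by exact/local1/local_marg.
rewrite opprK -RintegralB//; [|exact: local_integrable..].
have dL : depends_on (x |` K)%fset (marg a K).
  exact: (depends_onS (fsubsetU1 x K) (@depends_marg _ _ _ _ a K)).
rewrite !(@Rintegral_depends _ _ _ _ a (x |` K)%fset).
- apply: eq_bigr => s _.
  have [->|m0] := eqVneq (marg a (x |` K)%fset (ext plus s)) 0; first by rewrite !mulr0.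
  rewrite /condp; congr (_ * _).
  have m1 : 0 < marg a (x |` K)%fset (ext plus s) by rewrite lt_def m0 marg_ge0.
  rewrite ln_div// posrE//; apply: (lt_le_trans m1).
  by rewrite marg_anti// fsubsetU1.
- by move=> w w' ww'; congr (ln (_ / _)); [exact: depends_marg|exact: dL].
- by move=> w w' ww'; congr (ln _ - ln _); [exact: depends_marg|exact: dL].
Qed.

Lemma cond_entropy_shift K x : translation_invariant plus a ->
  cond_entropy (fshift K (sopp x)) (site0 d) = cond_entropy K x.
Proof.
move=> ta; rewrite /cond_entropy -(Rintegral_tau x ta); last exact: local_ln_condp.
congr (- _); apply: eq_Rintegral => w _; rewrite /condp; congr (ln (_ / _)).
  rewrite -[RHS](marg_tau _ x)//; congr (marg _ _ _).
  apply/fsetP => y; rewrite !(inE, mem_fshift); congr (_ || _).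
  by rewrite -(inj_eq (@sadd_inj _ x)) sadd0.
exact: marg_tau.
Qed.

Lemma entropy_density_cvg : translation_invariant plus a ->
  exists s : R, (fun n => (#|` Lambda d n|%fset)%:R^-1 *
    \int[a]_w ln (marg a (Lambda d n) w)) @ \oo --> s.
Proof.
move=> ta.
pose F L : R := - cond_entropy (past L) (site0 d).
have past0 L : site0 d \notin past L by rewrite !inE lex_ltxx andbF.
have pastS L L' : (L `<=` L')%fset -> (past L `<=` past L')%fset.
  move=> LL'; apply/fsubsetP => y; rewrite !inE => /andP[yL ->].
  by rewrite (fsubsetP LL' _ yL).
pose S := [set u : R | exists K, u = cond_entropy (past K) (site0 d)].
have Slb : has_lbound S by exists 0 => _ [K ->]; exact: cond_entropy_ge0.
have Sinf : has_inf S by split => //; exists (cond_entropy (past fset0) (site0 d)), fset0.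
(* The infimum over finite pieces plays the role of the entropy given the whole past. *)
exists (- inf S).
have step L : \int[a]_w ln (marg a L w) = \sum_(x <- L) F (fshift L (sopp x)).
  have := @telescope_fset R _ (@lex_lt d) (fun M => \int[a]_w ln (marg a M w)) L
    (@lex_ltxx d) (@lex_lt_trans d) (@lex_lt_total d).
  have -> : \int[a]_w ln (marg a fset0 w) = 0.
    under eq_Rintegral do rewrite marg0 ln1.
    by rewrite Rintegral_prob_cst.
  rewrite subr0 => <-; rewrite !big_seq; apply: eq_bigr => x xL.
  have -> : [fset y in L | ~~ lex_lt x y]%fset = (x |` [fset y in L | lex_lt y x])%fset.
    apply/fsetP => y; rewrite !inE; have [->|yx]/= := eqVneq y x.
      by rewrite xL lex_ltxx.
    congr (_ && _); have := lex_lt_total yx.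
    have [yx' _|_ /= ->//] := boolP (lex_lt y x).
    by apply/negP => /(lex_lt_trans yx'); rewrite lex_ltxx.
  (* Translation by [-x] carries the sites of [L] before [x] to the past of the origin in
     [L - x]. *)
  rewrite cond_entropy_chain -(cond_entropy_shift [fset y in L | lex_lt y x]%fset x ta) /F.
  suff -> : fshift [fset y in L | lex_lt y x]%fset (sopp x) = past (fshift L (sopp x)) by [].
  apply/fsetP => y; rewrite !(inE, mem_fshift); congr (_ && _).
  by rewrite -{2}(sadd0 x) lex_lt_add2l.
under eq_fun do rewrite step.
(* Empty conditioning gives the largest of these entropies, hence the uniform bound. *)
apply: (@Lambda_average_cvg _ _ F (cond_entropy fset0 (site0 d))) => [L _|e e0].
  rewrite normrN ger0_norm ?cond_entropy_ge0//.
  by apply: cond_entropy_anti => //; exact: fsub0set.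
have [_ [K ->] hK] := inf_adherent e0 Sinf.
have [m Km] := fset_sub_Lambda K; exists m => L mL.
have h1 : inf S <= cond_entropy (past L) (site0 d) by apply: ge_inf => //; exists L.
have h2 : cond_entropy (past L) (site0 d) <= cond_entropy (past K) (site0 d).
  apply: cond_entropy_anti => //; apply: pastS; exact: fsubset_trans Km mL.
by rewrite /F ler_norml; lra.
Qed.

End entropy.

(** * Measurability of the set [Omega_le0] *)

Lemma countable_bigcapT_measurable (disp : measure_display) (T : measurableType disp)
    (I : Type) (F : I -> set T) : countable [set: I] ->
  (forall i, measurable (F i)) -> measurable (\bigcap_i F i).
Proof.
move=> cI mF; rewrite -[X in measurable X]setCK setC_bigcap; apply: measurableC.
by apply: countable_bigcupT_measurable => // i; exact: measurableC.
Qed.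

Section continuity_set.
Context (R : realType) (E : finType) (plus : E) (d : nat).
Local Notation Om := (Omega plus d).
Implicit Types (w v : Om) (L : {fset site d}) (G : Om -> R).

(** There are finitely many patterns on [L], so such a set is a finite union of cylinders. *)
Lemma saturated_measurable L (A : set Om) :
  (forall w w', (forall x, x \in L -> w x = w' x) -> A w -> A w') -> measurable A.
Proof.
move=> sA.
have -> : A = \bigcup_(s in [set s : {ffun L -> E} | A (ext plus s)]) cyl plus s.
  apply/seteqP; split=> [w Aw|w [s /= As ws]].
    exists (restr L w); last by rewrite -boxE.
    by apply: sA Aw => x xL; rewrite restrK.
  apply: sA As => x xL; have := ws [` xL]%fset => /= ->.
  by rewrite (extE _ _ [` xL]%fset).
apply: fin_bigcup_measurable => [|s _]; last exact: measurable_cyl.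
exact: finite_finset.
Qed.

(* Unlike the modulus of continuity at [w^+], this oscillation only depends on
   the coordinates of [w] in [Lambda_m], which makes the set a finite union of
   cylinders. *)
Definition small_osc G (m : nat) (e : R) : set Om :=
  [set w | forall v v', (forall x, x \in Lambda d m -> v x = conf_plus plus w x) ->
     (forall x, x \in Lambda d m -> v' x = conf_plus plus w x) -> `|G v - G v'| <= e].

Lemma small_osc_saturated G m e w w' :
  (forall x, x \in Lambda d m -> w x = w' x) -> small_osc G m e w -> small_osc G m e w'.
Proof.
by move=> ww' h v v' hv hv'; apply: h => x xm; rewrite /conf_plus ww'// ?hv ?hv'.
Qed.

Lemma measurable_small_osc G m e : measurable (small_osc G m e).
Proof. exact: (@saturated_measurable (Lambda d m) _ (@small_osc_saturated G m e)). Qed.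

Lemma small_osc_mono G m n e : (m <= n)%N -> small_osc G m e `<=` small_osc G n e.
Proof.
by move=> mn w h v v' hv hv'; apply: h => x xm; rewrite ?hv ?hv'//;
  exact: (fsubsetP (sub_Lambda d mn)).
Qed.

Lemma continuous_small_osc G w e : 0 < e ->
  continuous_at_conf plus G (conf_plus plus w) -> exists m, small_osc G m e w.
Proof.
move=> e0 /(_ (e / 2)); rewrite divr_gt0// => /(_ isT)[D hD].
have [m Dm] := fset_sub_Lambda D; exists m => v v' hv hv'.
have hh u : (forall x, x \in Lambda d m -> u x = conf_plus plus w x) ->
    `|G u - G (conf_plus plus w)| < e / 2.
  by move=> hu; apply: hD => x /= xD; rewrite hu//; exact: (fsubsetP Dm).
have := hh _ hv; have := hh _ hv'; rewrite !ltr_norml ler_norml; lra.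
Qed.

(** Continuity at [w^+] means that for every [k] some box brings the oscillation down to [1/(k+1)],
    a condition built from countably many measurable sets. *)
Lemma measurable_continuous_plus G :
  measurable [set w : Om | continuous_at_conf plus G (conf_plus plus w)].
Proof.
have -> : [set w : Om | continuous_at_conf plus G (conf_plus plus w)] =
    \bigcap_k \bigcup_m small_osc G m (k.+1%:R^-1).
  apply/seteqP; split=> [w Gw k _|w h e e0].
    have [|m hm] := @continuous_small_osc G w k.+1%:R^-1 _ Gw.
      by rewrite invr_gt0.
    by exists m.
  have [k ke] : exists k, k.+1%:R^-1 < e.
    have := @near_infty_natSinv_lt R (PosNum e0) => -[k _ /(_ k)] /=.
    by rewrite leqnn => /(_ isT) ?; exists k.
  have [m _ hm] := h k I.
  exists (Lambda d m) => w' ww'; apply: le_lt_trans ke; apply: hm => // x xm.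
  by rewrite ww'.
apply: bigcap_measurableType => k _; apply: bigcup_measurable => m _.
exact: measurable_small_osc.
Qed.

Lemma continuous_at_conf_sum (I : Type) (r : seq I) (c : I -> R) (F : I -> Om -> R) w :
  (forall i, continuous_at_conf plus (F i) w) ->
  continuous_at_conf plus (fun v => \sum_(i <- r) c i * F i v) w.
Proof.
move=> cF; elim: r => [|i r IH] e e0.
  by exists fset0 => w' _; rewrite !big_nil subrr normr0.
(* The [+ 1] covers the case [c i = 0]. *)
have c0 : 0 < 2 * (`|c i| + 1) by rewrite mulr_gt0// ltr_wpDl.
have [|D hD] := cF i (e / (2 * (`|c i| + 1))); first by rewrite divr_gt0.
have [|D' hD'] := IH (e / 2); first by rewrite divr_gt0.
exists (D `|` D')%fset => w' ww'.
have h2 : `|F i w' - F i w| < e / (2 * (`|c i| + 1)).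
  by apply: hD => x /= xD; apply: ww'; rewrite /= inE xD.
have h1 : `|\sum_(i <- r) c i * F i w' - \sum_(i <- r) c i * F i w| < e / 2.
  by apply: hD' => x /= xD; apply: ww'; rewrite /= inE xD orbT.
rewrite !big_cons.
rewrite opprD addrACA -mulrBr (le_lt_trans (ler_normD _ _))//.
rewrite [ltRHS]splitr ler_ltD// normrM (le_trans (ler_wpM2l (normr_ge0 _) (ltW h2)))//.
rewrite mulrCA ler_pM2l// ler_pdivrMr// mulrA mulVf ?mul1r ?lerDl//.
Qed.

Lemma countable_fset_site : countable [set: {fset site d}].
Proof. exact: countableP. Qed.

Variable g : kernel_family R plus d.

(** A local function is a finite combination of cylinder indicators, so continuity need only be
    tested on the countably many pairs of a volume and a cylinder. *)
Lemma Omega_le0E : Omega_le0 plus g =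
  \bigcap_(L in [set: {fset site d}]) \bigcap_(D in [set: {fset site d}])
  \bigcap_(s in [set: {ffun D -> E}])
    [set w : Om | continuous_at_conf plus (fun v => fine (g L v (cyl plus s)))
                    (conf_plus plus w)].
Proof.
apply/seteqP; split=> [w hw L _ D _ s _|w hw L f [D hf]] /=.
  have := hw L (fun v => \1_(cyl plus s) v).
  have -> : (fun w' => fine (\int[g L w']_x (\1_(cyl plus s) x)%:E)) =
      (fun v => fine (g L v (cyl plus s))).
    by apply/funext => v; rewrite integral_indic ?setIT//; exact: measurable_cyl.
  apply; exists D => U mU.
  have := @measurable_indic _ (g_sigma_algebraType (coordG plus [set x | x \in D])) R
     setT (cyl plus s).
  have cs : FD plus [set x | x \in D] (cyl plus s) by rewrite cylE; exact: FD_box.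
  by move=> /(_ cs measurableT U mU); rewrite setTI.
have fD : depends_on D f.
  move=> v v' vv'; apply: (@FD_fun_depends _ _ _ [set x | x \in D]) => // u.
  by apply: hf; exact: measurable_set1.
have -> : (fun w' => fine (\int[g L w']_x (f x)%:E)) =
    (fun v => \sum_(s : {ffun D -> E}) f (ext plus s) * fine (g L v (cyl plus s))).
  apply/funext => v; rewrite -[LHS]/(Rintegral (g L v) setT f) (Rintegral_depends _ fD).
  by apply: eq_bigr => s _; rewrite /marg cylE.
by apply: continuous_at_conf_sum => s; exact: hw.
Qed.

(* The value of a measure on a non-measurable set is unspecified, so that
   [a (Omega_le0 plus g) = 1] is only usable through this lemma. *)
Lemma measurable_Omega_le0 : measurable (Omega_le0 plus g).
Proof.
rewrite Omega_le0E; apply: countable_bigcapT_measurable => [|L]; first exact: countable_fset_site.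
apply: countable_bigcapT_measurable => [|D]; first exact: countable_fset_site.
apply: countable_bigcapT_measurable => [|s]; last exact: measurable_continuous_plus.
exact: countableP.
Qed.

End continuity_set.

(** * Limits along growing finite sets, and a Lipschitz bound for [ln] *)

Lemma fset_net_cvg (R : realType) d (F : {fset site d} -> R) :
  (forall e, 0 < e -> exists m, forall L L', (Lambda d m `<=` L)%fset ->
     (Lambda d m `<=` L')%fset -> `|F L - F L'| <= e) ->
  exists l, forall e, 0 < e ->
    exists m, forall L, (Lambda d m `<=` L)%fset -> `|F L - l| <= e.
Proof.
(* [S] collects the eventual lower bounds of [F]; its supremum is the lower limit. *)
move=> cF; pose S := [set u : R | exists m, forall L, (Lambda d m `<=` L)%fset -> u <= F L].
have Sub e m : (forall L L', (Lambda d m `<=` L)%fset ->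
     (Lambda d m `<=` L')%fset -> `|F L - F L'| <= e) -> ubound S (F (Lambda d m) + e).
  move=> hm u [m' hu].
  have := hu (Lambda d m `|` Lambda d m')%fset (fsubsetUr _ _).
  have := hm (Lambda d m `|` Lambda d m')%fset _ (fsubsetUl _ _) (fsubset_refl _).
  by rewrite ler_norml; lra.
have Smem e m : (forall L L', (Lambda d m `<=` L)%fset ->
     (Lambda d m `<=` L')%fset -> `|F L - F L'| <= e) -> S (F (Lambda d m) - e).
  move=> hm; exists m => L mL.
  by have := hm L (Lambda d m) mL (fsubset_refl _); rewrite ler_norml; lra.
exists (sup S) => e e0; have [|m hm] := cF (e / 2); first by rewrite divr_gt0.
exists m => L mL.
have h1 : sup S <= F (Lambda d m) + e / 2.
  by apply: ge_sup; [exists (F (Lambda d m) - e / 2); exact: Smem|exact: Sub].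
have h2 : F (Lambda d m) - e / 2 <= sup S.
  by apply: ub_le_sup; [exists (F (Lambda d m) + e / 2); exact: Sub|exact: Smem].
have := hm L (Lambda d m) mL (fsubset_refl _); rewrite !ler_norml; lra.
Qed.

Lemma ln_lipschitz (R : realType) (c p q : R) : 0 < c -> c <= p -> c <= q ->
  `|ln p - ln q| <= `|p - q| / c.
Proof.
move=> c0.
suff h (s t : R) : c <= s -> c <= t -> ln s - ln t <= `|s - t| / c.
  move=> cp cq; rewrite ler_norml h// andbT.
  by have := h _ _ cq cp; rewrite distrC; lra.
move=> cs ct; have s0 := lt_le_trans c0 cs; have t0 := lt_le_trans c0 ct.
rewrite -ln_div ?posrE//.
have st0 : 0 < s / t by rewrite divr_gt0.
have : ln (1 + (s / t - 1)) <= s / t - 1 by apply: le_ln1Dx; lra.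
rewrite addrC subrK => /le_trans; apply.
have -> : s / t - 1 = (s - t) / t by rewrite mulrBl divff// gt_eqF.
apply: (@le_trans _ _ (`|s - t| / t)).
  by rewrite ler_pM2r ?invr_gt0// ler_norm.
by rewrite ler_wpM2l// lef_pV2// posrE.
Qed.

(** * Log-ratios of Gibbs measures and the cross-entropy density *)

Section gibbs.
Context (R : realType) (E : finType) (plus : E) (d : nat).
Local Notation Om := (Omega plus d).
Local Notation o := (site0 d).
Variable g : kernel_family R plus d.
Hypothesis spec : is_specification plus g.
Hypothesis nn : nonnull plus g.
Implicit Types (w v : Om) (K L : {fset site d}) (r a : probability Om R).

Definition gam e w : R := fine (g [fset o]%fset w [set w' : Om | w' o = e]).

Lemma coord_cyl e :
  [set w : Om | w o = e] = cyl plus ([ffun=> e] : {ffun [fset o]%fset -> E}).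
Proof.
apply/seteqP; split=> w /= h.
  by move=> x; rewrite ffunE -h; have := fsvalP x; rewrite inE => /eqP ->.
by have := h [` fset11 o]%fset; rewrite ffunE.
Qed.

Lemma gamE e w : g [fset o]%fset w [set w' : Om | w' o = e] = (gam e w)%:E.
Proof. by rewrite fine_probabilityK//; exact: measurable_coord. Qed.

Lemma gam_bounds : exists2 c : R, 0 < c & forall e w, c <= gam e w /\ gam e w <= 1.
Proof.
have [|c [b [c0 [_ h]]]] := nn (L := [fset o]%fset).
  by apply/fset0Pn; exists o; rewrite inE.
exists c => // e w; rewrite -!lee_fin -gamE; split.
  by rewrite coord_cyl; have [/ltW] := h [ffun=> e] w.
by apply: probability_le1; exact: measurable_coord.
Qed.

(** The kernel of the volume [{o}] is measurable with respect to the sites other than [o], hence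
    blind to the spin at [o]. *)
Lemma gam_upd e w e' : gam e (upd w o e') = gam e w.
Proof.
have [mg _ _] := spec.
rewrite /gam; congr fine.
apply: (@FD_fun_depends _ _ _ (compl_of [fset o]%fset) _
   (fun w => g [fset o]%fset w [set w' : Om | w' o = e])).
  by move=> v; apply: mg; [exact: measurable_coord|exact: emeasurable_set1].
move=> x; rewrite /compl_of /= inE /upd; case: eqP => //.
Qed.

Lemma FD_measurable (D : set (site d)) (A : set Om) : FD plus D A -> measurable A.
Proof.
apply: smallest_sub; first exact: smallest_sigma_algebra.
by move=> _ [x [e [_ ->]]]; exact: measurable_coord.
Qed.

Lemma measurable_kernel L (A : set Om) : measurable A ->
  measurable_fun setT (fun w => g L w A).
Proof.
move=> mA _ U mU; rewrite setTI; apply: (@FD_measurable (compl_of L)).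
by case: spec => + _ _; apply.
Qed.

(** As [o] is outside [K], the cylinder over [K] is an exterior event for [o]. The Gibbs property
    then writes the mass of the extended cylinder as the integral of the kernel over it, and bounds
    on the kernel pass to the mass. *)
Lemma gibbs_marg_bounds r K w e (lo hi : R) : gibbs plus g r -> o \notin K -> 0 <= lo ->
  (forall v, box K w v -> lo <= gam e v <= hi) ->
  lo * marg r K w <= marg r (o |` K)%fset (upd w o e) <= hi * marg r K w.
Proof.
move=> gr oK lo0 hv.
have mB := measurable_box K w; have mA := @measurable_coord E plus d o e.
have -> : marg r (o |` K)%fset (upd w o e) =
    fine (\int[r]_(v in box K w) g [fset o]%fset v [set w' : Om | w' o = e])%E.
  rewrite /marg box_upd// setIC (gr [fset o]%fset)//.
  by apply: FD_box => x /= xK; rewrite /compl_of /= inE => /eqP xo; move: oK; rewrite -xo xK.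
have cstE (c : R) : (\int[r]_(v in box K w) c%:E = (c * marg r K w)%:E)%E.
  by rewrite integral_cst// EFinM fine_probabilityK.
have I1 : ((lo * marg r K w)%:E <=
    \int[r]_(v in box K w) g [fset o]%fset v [set w' : Om | w' o = e])%E.
  rewrite -cstE; apply: ge0_le_integral => //.
    exact: measurable_funTS (measurable_kernel _ mA).
  by move=> v /hv/andP[h _]; rewrite gamE lee_fin.
have I2 : (\int[r]_(v in box K w) g [fset o]%fset v [set w' : Om | w' o = e]
    <= (hi * marg r K w)%:E)%E.
  rewrite -cstE; apply: ge0_le_integral => //.
    exact: measurable_funTS (measurable_kernel _ mA).
  by move=> v /hv/andP[_ h]; rewrite gamE lee_fin.
set I := (\int[r]_(v in box K w) _)%E in I1 I2 *.
have If : I \is a fin_num by rewrite fin_numElt (lt_le_trans _ I1) ?ltNyr// (le_lt_trans I2)// ltry.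
by rewrite -!lee_fin fineK// I1 I2.
Qed.

(** By the Gibbs property the mass is an average of kernel values, all above the nonnullness
    constant of [L]. *)
Lemma gibbs_marg_gt0 r L w : gibbs plus g r -> 0 < marg r L w.
Proof.
move=> gr; have [->|L0] := eqVneq L fset0; first by rewrite marg0.
have [c [b [c0 [_ hc]]]] := nn L0.
apply: (lt_le_trans c0); have mB := measurable_box L w.
rewrite -lee_fin fine_probabilityK// -[box L w]setIT (gr L)//; last first.
  exact: (@measurableT _ (g_sigma_algebraType (coordG plus (compl_of L)))).
have -> : c%:E = (\int[r]_(v in setT) c%:E)%E.
  by rewrite integral_cst//= probability_setT mule1.
apply: ge0_le_integral => //.
- by move=> v _; rewrite lee_fin ltW.
- exact: measurable_kernel.
- by move=> v _; rewrite boxE; have [/ltW] := hc (restr L w) v.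
Qed.

Definition condg r K e w : R := marg r (o |` K)%fset (upd w o e) / marg r K w.

Lemma condg_bounds r K w e (lo hi : R) : gibbs plus g r -> o \notin K -> 0 <= lo ->
  (forall v, box K w v -> lo <= gam e v <= hi) -> lo <= condg r K e w <= hi.
Proof.
move=> gr oK lo0 h; have m0 := gibbs_marg_gt0 K w gr.
by rewrite ler_pdivlMr// ler_pdivrMr//; exact: gibbs_marg_bounds.
Qed.

(** One increment of the telescoped sum, moved to the origin: the spin at [o] passes from [plus] to
    [w o] while all later sites are [plus]. *)
Definition log_ratio r L w : R :=
  ln (marg r L (conf_plus plus w)) - ln (marg r L (upd (conf_plus plus w) o plus)).

(** The mass of the cylinder over [L] without [o] is common to both terms and cancels. *)
Lemma log_ratioE r L w : gibbs plus g r -> o \in L ->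
  log_ratio r L w = ln (condg r (L `\ o)%fset (w o) (conf_plus plus w))
                    - ln (condg r (L `\ o)%fset plus (conf_plus plus w)).
Proof.
move=> gr oL; rewrite /condg fsetD1K//.
have -> : upd (conf_plus plus w) o (w o) = conf_plus plus w.
  by rewrite -[RHS](upd_id _ o) /conf_plus lex_ltxx.
by rewrite !ln_div ?posrE ?gibbs_marg_gt0// /log_ratio; lra.
Qed.

Lemma local_log_ratio r L : local (log_ratio r L).
Proof.
exists L => w w' ww'; rewrite /log_ratio; congr (ln _ - ln _);
  by apply: depends_marg => x xL; rewrite /upd /conf_plus ww'.
Qed.

Lemma log_ratio_bounded : exists B : R, forall r L w, gibbs plus g r -> o \in L ->
  `|log_ratio r L w| <= B.
Proof.
have [c c0 hc] := gam_bounds; exists (- ln c - ln c) => r L w gr oL.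
rewrite log_ratioE//.
have h e : ln c <= ln (condg r (L `\ o)%fset e (conf_plus plus w)) <= 0.
  have /andP[h1 h2] : c <= condg r (L `\ o)%fset e (conf_plus plus w) <= 1.
    apply: condg_bounds => //; rewrite ?ltW// ?fsetD11// => v _.
    by apply/andP; exact: hc.
  by rewrite ler_ln ?posrE// ?h1 ?ln_le0// (lt_le_trans c0).
have := h (w o); have := h plus; rewrite ler_norml; lra.
Qed.

(** All the conditional probabilities are averages of the same kernel near [w^+], hence within [e]
    of its value there. Two logarithms, each with error [2 * e] and Lipschitz constant [1 / c], give
    [4 * e / c]. *)
Lemma log_ratio_osc : exists2 c : R, 0 < c & forall r r' L L' w m e, 0 < e ->
  gibbs plus g r -> gibbs plus g r' -> (Lambda d m `<=` L)%fset -> (Lambda d m `<=` L')%fset ->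
  (forall s, small_osc (gam s) m e w) ->
  `|log_ratio r L w - log_ratio r' L' w| <= 4 * e / c.
Proof.
have [c c0 hc] := gam_bounds; exists c => // r r' L L' w m e e0 gr gr' mL mL' osc.
have oL := fsubsetP mL _ (site0_Lambda d m); have oL' := fsubsetP mL' _ (site0_Lambda d m).
have cond (q : probability Om R) M s : gibbs plus g q -> (Lambda d m `<=` M)%fset ->
    c <= condg q (M `\ o)%fset s (conf_plus plus w) /\
    `|condg q (M `\ o)%fset s (conf_plus plus w) - gam s (conf_plus plus w)| <= e.
  move=> gq mM; set t := gam s (conf_plus plus w).
  (* The maximum with [c] keeps the lower bound positive, also for the Lipschitz estimate. *)
  have : Num.max c (t - e) <= condg q (M `\ o)%fset s (conf_plus plus w) <= t + e.
    apply: condg_bounds => //; rewrite ?fsetD11// ?le_max ?(ltW c0)// => v hv.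
    (* On the box, [v] is known to agree with [w^+] only away from [o]. Resetting its spin at [o]
       leaves [gam s] unchanged and makes it agree with [w^+] on all of [Lambda d m]. *)
    have := osc s (upd v o (conf_plus plus w o)) (conf_plus plus w).
    rewrite gam_upd -/t ge_max (hc s v).1 /=.
    have h x : x \in Lambda d m -> upd v o (conf_plus plus w o) x = conf_plus plus w x.
      move=> xm; rewrite /upd; case: eqP => [->//|/eqP xo].
      by apply: hv; rewrite !inE xo (fsubsetP mM).
    move=> /(_ h (fun _ _ => erefl)); rewrite ler_norml; lra.
  by rewrite ge_max ler_norml => /andP[/andP[-> h1] h2]; split => //; lra.
have lip s : `|ln (condg r (L `\ o)%fset s (conf_plus plus w)) -
     ln (condg r' (L' `\ o)%fset s (conf_plus plus w))| <= 2 * e / c.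
  have [h1 h2] := cond _ _ s gr mL; have [h3 h4] := cond _ _ s gr' mL'.
  apply: (le_trans (ln_lipschitz c0 h1 h3)); rewrite ler_pM2r ?invr_gt0//.
  by move: h2 h4; rewrite !ler_norml; lra.
rewrite !log_ratioE//; have := lip (w o); have := lip plus.
have -> : 4 * e / c = 2 * e / c + 2 * e / c by rewrite -mulrDl; congr (_ / _); lra.
by rewrite !ler_norml; lra.
Qed.

(** These sets increase with [m] and their union contains [Omega_le0], so their masses tend to 1. *)
Lemma small_osc_prob a (e : R) : a (Omega_le0 plus g) = 1%E -> 0 < e ->
  exists m, 1 - e <= fine (a (\bigcap_s small_osc (gam s) m e)).
Proof.
move=> a1 e0; pose A m : set Om := \bigcap_s small_osc (gam s) m e.
have mA m : measurable (A m).
  apply: countable_bigcapT_measurable => [|s]; first exact: countableP.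
  exact: measurable_small_osc.
have mU : measurable (\bigcup_m A m) by apply: bigcup_measurable => m _; exact: mA.
have homoA : {homo A : n m / (n <= m)%N >-> (n <= m)%O}.
  by move=> m n mn; apply/subsetPset => w h s _; apply: (small_osc_mono mn); exact: h.
have sub : Omega_le0 plus g `<=` \bigcup_m A m.
  move=> w; rewrite Omega_le0E => hw.
  have hs s : exists m, small_osc (gam s) m e w.
    apply: continuous_small_osc => //.
    by have := hw [fset o]%fset I [fset o]%fset I [ffun=> s] I; rewrite /= -coord_cyl.
  (* [E] is finite, so the largest box serves all spins at once. *)
  have [f hf] := choice hs; exists (\max_s f s)%N => // s _.
  by apply: (small_osc_mono (leq_bigmax s)); exact: hf.
have aU : a (\bigcup_m A m) = 1%E.
  apply/eqP; rewrite eq_le probability_le1//= -a1.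
  by apply: le_measure; rewrite ?inE//; exact: measurable_Omega_le0.
have : (a \o A) @ \oo --> 1%:E by rewrite -[1%:E]aU; exact: nondecreasing_cvg_mu.
move=> /fine_cvg/cvgrPdist_le /(_ _ e0)[m _ /(_ m)] /=; rewrite leqnn => /(_ isT) h.
by exists m; move: h; rewrite ler_norml; lra.
Qed.

(** Where the oscillation is small the log-ratios differ by at most [4 * e' / c]; the complement has
    mass at most [e'], and there the uniform bound gives [2 * |B|]. *)
Lemma log_ratio_cauchy a (e : R) : a (Omega_le0 plus g) = 1%E -> 0 < e ->
  exists m, forall r r' L L', gibbs plus g r -> gibbs plus g r' ->
    (Lambda d m `<=` L)%fset -> (Lambda d m `<=` L')%fset ->
    `|\int[a]_w log_ratio r L w - \int[a]_w log_ratio r' L' w| <= e.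
Proof.
move=> a1 e0; have [B hB] := log_ratio_bounded; have [c c0 hc] := log_ratio_osc.
(* Chosen so that the total error [(4 / c + 2 * |B|) * e'] stays below [k * e' = e]. *)
pose k := 4 / c + 2 * `|B| + 1.
have k0 : 0 < k by rewrite /k ltr_wpDl// addr_ge0 ?mulr_ge0 ?invr_ge0// ltW.
pose e' := e / k; have e'0 : 0 < e' by rewrite divr_gt0.
have [m hm] := small_osc_prob a1 e'0; exists m => r r' L L' gr gr' mL mL'.
pose A : set Om := \bigcap_s small_osc (gam s) m e'.
have mA : measurable A.
  apply: countable_bigcapT_measurable => [|s]; first exact: countableP.
  exact: measurable_small_osc.
have lA : local (fun w => \1_(~` A) w : R).
  exists (Lambda d m) => w w' ww'; rewrite !indicE; congr (_%:R); congr nat_of_bool.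
  have sA v v' : (forall x, x \in Lambda d m -> v x = v' x) -> A v -> A v'.
    by move=> vv' Av s _; apply: (small_osc_saturated vv'); exact: Av.
  apply/idP/idP => /set_mem h; apply/mem_set => /= Aw; apply: h; apply: sA Aw => // x xm.
  by rewrite ww'.
have oL := fsubsetP mL _ (site0_Lambda d m); have oL' := fsubsetP mL' _ (site0_Lambda d m).
have lD : local (fun w => log_ratio r L w - log_ratio r' L' w).
  exact: (local2 (fun s t => s - t) (local_log_ratio r L) (local_log_ratio r' L')).
rewrite -RintegralB//; [|by apply: local_integrable; exact: local_log_ratio..].
apply: (le_trans (le_normr_Rintegral _ _)) => //; first exact: local_integrable.
have lB : local (fun w => 2 * `|B| * \1_(~` A) w).
  by apply: (@local1 _ _ _ _ (fun u => 2 * `|B| * u)).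
apply: (@le_trans _ _ (\int[a]_w (4 * e' / c + 2 * `|B| * \1_(~` A) w))).
  apply: le_Rintegral => //.
  - by apply: local_integrable; apply: (@local1 _ _ _ _ Num.norm).
  - apply: local_integrable; apply: (@local2 _ _ _ _ (fun s t => s + t)) => //.
    exact: local_cst.
  move=> w _; rewrite indicE; have [Aw|Aw] := pselect (A w).
    rewrite memNset; last exact.
    by rewrite mulr0 addr0; apply: (hc _ _ _ _ _ m) => // s; exact: Aw.
  rewrite mem_set// mulr1.
  have B1 := ler_norm B; have h1 := hB r L w gr oL; have h2 := hB r' L' w gr' oL'.
  have h3 : 0 <= 4 * e' / c by apply: divr_ge0; [apply: mulr_ge0 => //; exact: ltW|exact: ltW].
  by rewrite (le_trans (ler_normB _ _))//; lra.
rewrite RintegralD//; [|by apply: local_integrable; exact: local_cst|exact: local_integrable].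
rewrite Rintegral_prob_cst RintegralZl//; last exact: local_integrable.
rewrite /Rintegral integral_indic ?setIT//; last exact: measurableC.
have -> : fine (a (~` A)) = 1 - fine (a A).
  by rewrite probability_setC// fineB ?fin_num_measure.
have h : 1 - fine (a A) <= e' by move: hm; rewrite -/A; lra.
apply: (@le_trans _ _ (4 * e' / c + 2 * `|B| * e')).
  by rewrite lerD2l ler_wpM2l// mulr_ge0.
have -> : e = (4 / c + 2 * `|B| + 1) * e' by rewrite /e' -/k mulrCA divff ?mulr1// gt_eqF.
by rewrite [leRHS]mulrDl mul1r [in leRHS]mulrDl (mulrAC 4 e') lerDl ltW.
Qed.

(** The Cauchy property for [nu] yields [l]; comparing [r] with [nu] on the same [L] shows that
    every Gibbs measure has this limit. *)
Lemma log_ratio_limit a nu : a (Omega_le0 plus g) = 1%E -> gibbs plus g nu ->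
  exists l : R, forall r, gibbs plus g r -> forall e, 0 < e ->
    exists m, forall L, (Lambda d m `<=` L)%fset -> `|\int[a]_w log_ratio r L w - l| <= e.
Proof.
move=> a1 gnu.
have [|l hl] := @fset_net_cvg R d (fun L => \int[a]_w log_ratio nu L w).
  by move=> e e0; have [m hm] := log_ratio_cauchy a1 e0; exists m => L L'; exact: hm.
exists l => r gr e e0; have e20 : 0 < e / 2 by rewrite divr_gt0.
have [m hm] := hl _ e20; have [m' hm'] := log_ratio_cauchy a1 e20.
exists (maxn m m') => L mL.
have mmL : (Lambda d m `<=` L)%fset by apply: fsubset_trans mL; rewrite sub_Lambda// leq_maxl.
have mmL' : (Lambda d m' `<=` L)%fset by apply: fsubset_trans mL; rewrite sub_Lambda// leq_maxr.
have := hm L mmL; have := hm' r nu L L gr gnu mmL' mmL'.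
by rewrite !ler_norml; lra.
Qed.

Lemma log_marg_telescope a r L : translation_invariant plus a -> translation_invariant plus r ->
  \int[a]_w ln (marg r L w) - ln (marg r L (fun=> plus)) =
  \sum_(x <- L) \int[a]_w log_ratio r (fshift L (sopp x)) w.
Proof.
(* On [L], these configurations interpolate between all [plus] at [M = fset0] and [w] at [M = L]. *)
move=> ta tr; pose mix (M : {fset site d}) w : Om := fun y => if y \in M then w y else plus.
have lmix M : local (fun w => ln (marg r L (mix M w))).
  exists L => w w' ww'; congr ln; apply: depends_marg => x xL.
  by rewrite /mix ww'.
have := @telescope_fset R _ (@lex_lt d) (fun M => \int[a]_w ln (marg r L (mix M w))) L
    (@lex_ltxx d) (@lex_lt_trans d) (@lex_lt_total d).
have -> : \int[a]_w ln (marg r L (mix L w)) = \int[a]_w ln (marg r L w).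
  by apply: eq_Rintegral => w _; congr ln; apply: depends_marg => x xL; rewrite /mix xL.
have -> : \int[a]_w ln (marg r L (mix fset0 w)) = ln (marg r L (fun=> plus)).
  by rewrite -[RHS](Rintegral_prob_cst a); apply: eq_Rintegral.
move=> <-; rewrite !big_seq; apply: eq_bigr => x xL.
rewrite -RintegralB//; [|exact: local_integrable..].
rewrite -[RHS](Rintegral_tau x ta); last exact: local_log_ratio.
apply: eq_Rintegral => w _; rewrite /log_ratio; congr (ln _ - ln _).
  (* With the sites up to [x] taken from [w], translation by [x] gives [(tau_x w)^+] on the shifted
     set. *)
  rewrite -(marg_tau _ x)//; apply: depends_marg => y; rewrite mem_fshift => yL.
  by rewrite /tau /mix !inE yL /= /conf_plus -{1}(sadd0 x) lex_lt_add2l if_neg.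
(* With only the sites strictly before [x] taken from [w], the origin carries [plus] as well. *)
rewrite -(marg_tau _ x)//; apply: depends_marg => y; rewrite mem_fshift => yL.
rewrite /tau /mix !inE yL /= /upd /conf_plus -{2}(sadd0 x) lex_lt_add2l.
have [->|yo] := eqVneq y o; first by rewrite lex_ltxx.
have := lex_lt_total yo; have [h _|_ /= ->//] := boolP (lex_lt y o).
by case: ifP => // /(lex_lt_trans h); rewrite lex_ltxx.
Qed.

(** The limit [l] is quantified before [r]: being common to all invariant Gibbs measures, it allows
    [mu] and [nu] to be compared. *)
Lemma cross_entropy_density_cvg a nu :
  translation_invariant plus a -> a (Omega_le0 plus g) = 1%E -> gibbs plus g nu ->
  exists l : R, forall r, gibbs_inv plus g r ->
    (fun n => (#|` Lambda d n|%fset)%:R^-1 * (\int[a]_w ln (marg r (Lambda d n) w)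
       - ln (marg r (Lambda d n) (fun=> plus)))) @ \oo --> l.
Proof.
move=> ta a1 gnu; have [l hl] := log_ratio_limit a1 gnu.
have [B hB] := log_ratio_bounded.
exists l => r [gr tr]; under eq_fun do rewrite log_marg_telescope//.
apply: (@Lambda_average_cvg _ _ (fun L => \int[a]_w log_ratio r L w) B); last exact: hl.
move=> L oL; apply: (le_trans (le_normr_Rintegral _ _)) => //.
  by apply: local_integrable; exact: local_log_ratio.
rewrite -[leRHS](Rintegral_prob_cst a); apply: le_Rintegral => //.
- by apply: local_integrable; apply: (@local1 _ _ _ _ Num.norm); exact: local_log_ratio.
- by apply: local_integrable; exact: local_cst.
- by move=> w _; exact: hB.
Qed.

End gibbs.

(** * Relative entropy and the conclusion *)

Section relative_entropy.
Context (R : realType) (E : finType) (plus : E) (d : nat).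
Local Notation Om := (Omega plus d).
Implicit Types a r : probability Om R.

(** Positivity of the [r]-masses splits the logarithm; cylinders of zero [a]-mass have weight 0 on
    both sides. *)
Lemma hLE a r L : (forall w, 0 < marg r L w) ->
  hL plus L a r = \int[a]_w ln (marg a L w) - \int[a]_w ln (marg r L w).
Proof.
move=> r0; rewrite -RintegralB//; [|exact/local_integrable/local1/local_marg..].
rewrite (@Rintegral_depends _ _ _ _ a L); last first.
  by move=> w w' ww'; congr (ln _ - ln _); exact: depends_marg.
apply: eq_bigr => s _; rewrite cylE -!/(marg _ _ _) mulrC.
have [->|m0] := eqVneq (marg a L (ext plus s)) 0; first by rewrite !mulr0.
by rewrite ln_div ?posrE// lt_def m0 marg_ge0.
Qed.

Lemma marg_plus r L : fine (r (cyl plus (plusL plus L))) = marg r L (fun=> plus).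
Proof.
rewrite /marg; congr (fine (r _)); apply/seteqP; split=> w /= h x.
  by move=> xL; rewrite (h [` xL]%fset) ffunE.
by rewrite h ?ffunE// fsvalP.
Qed.

End relative_entropy.

Theorem theorem3p4 (R : realType) (E : finType) (plus : E) (d : nat)
  (g : kernel_family R plus d) (nu mu : probability (Omega plus d) R) :
  (* gamma: translation-invariant nonnull specification *)
  is_specification plus g -> nonnull plus g -> translation_invariant_spec plus g ->
  (* nu in G_inv(gamma), mu in M^+_{1,inv} *)
  gibbs_inv plus g nu ->
  translation_invariant plus mu ->
  (* Condition C1 *)
  mu (Omega_le0 plus g) = 1%E ->
  (* Condition C2 *)
  gibbs_inv plus g mu ->
  (fun n => ((#|` Lambda d n|)%fset%:R)^-1 *
     ln (fine (mu (cyl plus (plusL plus (Lambda d n)))) /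
         fine (nu (cyl plus (plusL plus (Lambda d n)))))) @ \oo --> (0 : R) ->
  (* (1) h(mu|nu) exists and equals 0 *)
  h_seq plus mu nu @ \oo --> (0 : R) /\
  (* (2) e^+_nu exists and equals e^+_mu *)
  (exists e : R, eplus_seq plus nu @ \oo --> e /\ eplus_seq plus mu @ \oo --> e) /\
  (* (3) h(alpha|nu) exists for alpha in M^+_{1,inv} with alpha(Omega^{<=0}_gamma) = 1 *)
  (forall alpha : probability (Omega plus d) R,
     translation_invariant plus alpha -> alpha (Omega_le0 plus g) = 1%E ->
     exists l : R, h_seq plus alpha nu @ \oo --> l).
Proof.
move=> spec nn _ [gnu tnu] tmu mu1 [gmu _] C2.
pose c n : R := (#|` Lambda d n|%fset)%:R^-1.
pose lp (r : probability (Omega plus d) R) n := ln (marg r (Lambda d n) (fun=> plus)).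
pose ce (a r : probability (Omega plus d) R) n := \int[a]_w ln (marg r (Lambda d n) w).
have nu0 := fun L w => gibbs_marg_gt0 spec nn L w gnu.
have mu0 := fun L w => gibbs_marg_gt0 spec nn L w gmu.
have {}C2 : (fun n => c n * (lp mu n - lp nu n)) @ \oo --> (0 : R).
  move: C2; under eq_fun do rewrite !marg_plus ln_div ?posrE//.
  exact.
have hseqE a n : h_seq plus a nu n = c n * ce a a n - c n * ce a nu n.
  by rewrite /h_seq hLE// mulrBr.
have [l hl] := cross_entropy_density_cvg spec nn tmu mu1 gnu.
have hmu := hl mu (conj gmu tmu); have hnu := hl nu (conj gnu tnu).
have [s hs] := entropy_density_cvg tmu.
(* The entropy term of [mu] minus its cross term with itself leaves [ln mu(+)], whose density
   therefore exists. *)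
have lpmu : (fun n => c n * lp mu n) @ \oo --> s - l.
  have -> : (fun n => c n * lp mu n) =
      (fun n => c n * ce mu mu n - c n * (ce mu mu n - lp mu n)).
    by apply/funext => n; ring.
  exact: cvgB hs hmu.
(* Condition C2 transfers this density to [nu]. *)
have lpnu : (fun n => c n * lp nu n) @ \oo --> s - l.
  rewrite -[s - l]subr0.
  have -> : (fun n => c n * lp nu n) =
      (fun n => c n * lp mu n - c n * (lp mu n - lp nu n)).
    by apply/funext => n; ring.
  exact: cvgB lpmu C2.
split; [|split].
(* The cross terms of [mu] with [mu] and with [nu] share the limit [l] and cancel; C2 disposes of
   the remaining all-plus masses. *)
- have -> : h_seq plus mu nu = (fun n => c n * (ce mu mu n - lp mu n)
      - c n * (ce mu nu n - lp nu n) + c n * (lp mu n - lp nu n)).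
    by apply/funext => n; rewrite hseqE; ring.
  have -> : 0 = l - l + 0 :> R by rewrite subrr addr0.
  exact: cvgD (cvgB hmu hnu) C2.
- have eE r : eplus_seq plus r = (fun n => - (c n * lp r n)).
    by apply/funext => n; rewrite /eplus_seq marg_plus.
  by exists (- (s - l)); rewrite !eE; split; exact: cvgN.
- move=> alpha ta a1.
  have [l' hl'] := cross_entropy_density_cvg spec nn ta a1 gnu.
  have [s' hs'] := entropy_density_cvg ta.
  exists (s' - l' - (s - l)).
  (* Entropy of [alpha], cross term with [nu], and [ln nu(+)]: each of the three densities
     converges. *)
  have -> : h_seq plus alpha nu = (fun n => c n * ce alpha alpha n
      - c n * (ce alpha nu n - lp nu n) - c n * lp nu n).
    by apply/funext => n; rewrite hseqE; ring.
  exact: cvgB (cvgB hs' (hl' nu (conj gnu tnu))) lpnu.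
Qed.
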